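(* Let $(\bar M,\bar g)$ be an $(n+2)$-dimensional pseudo-Riemannian manifold of index $\nu$ with $0<\nu<n+2$, and let $(M,g,S(TM))$ be a lightlike hypersurface of $(\bar M,\bar g)$ with a given screen distribution $S(TM)$. Then the induced connection $\nabla$ on $M$ is a Weyl connection if and only if $(M,g)$ is totally geodesic. In particular, the induced connection on a proper totally umbilical lightlike hypersurface $(M,g,S(TM))$ is never a Weyl connection.
   Context: All objects are smooth. A hypersurface $M$ of $(\bar M,\bar g)$ is lightlike if the induced symmetric tensor $g=\bar g|_{TM}$ has constant rank $n$ on $M$ (note $\dim M=n+1$). Equivalently, the normal bundle $TM^\perp=\bigcup_{x\in M}T_xM^\perp$ is a rank-one distribution on $M$ contained in $TM$; it is then equal to the radical distribution $\mathrm{Rad}\,TM=TM\cap TM^\perp$. A screen distribution $S(TM)$ is a rank-$n$ distribution on $M$ complementary to $TM^\perp$ in $TM$ (it is automatically nondegenerate for $g$). Given $S(TM)$, there is a unique rank-one subbundle $tr(TM)$ of $T\bar M|_M$ such that for every nowhere zero section $\xi$ of $TM^\perp$ on a coordinate neighbourhood $\mathcal U\subset M$ there is a unique section $N$ of $tr(TM)$ on $\mathcal U$ with $\bar g(N,\xi)=1$, $\bar g(N,N)=0$ and $\bar g(N,W)=0$ for all $W\in\Gamma(S(TM)|_{\mathcal U})$. One has $T\bar M|_M=TM\oplus tr(TM)$. Let $\bar\nabla$ be the Levi-Civita connection of $\bar g$, and let $Q:T\bar M|_M\to TM$ be the projection along $tr(TM)$. The induced connection on $M$ is $\nabla_XY=Q(\bar\nabla_XY)$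 for $X,Y\in\Gamma(TM)$. The second fundamental form is given by $h(X,Y)=\bar\nabla_XY-\nabla_XY\in\Gamma(tr(TM))$. Locally $h(X,Y)=B(X,Y)N$ with $B(X,Y)=\bar g(\bar\nabla_XY,\xi)$. $(M,g)$ is totally geodesic if $h$ (equivalently $B$) vanishes identically. $(M,g)$ is totally umbilical if on each coordinate neighbourhood $\mathcal U$ there is a smooth function $\lambda$ with $B(X,Y)=\lambda g(X,Y)$ for all $X,Y\in\Gamma(TM|_{\mathcal U})$. It is proper totally umbilical if in addition $\lambda$ is nowhere vanishing. These notions do not depend on the choice of $\xi$. A linear connection $\nabla$ on $M$ is a Weyl connection if it is torsion-free and there is a smooth $1$-form $\theta$ on $M$ with $\nabla g=\theta\otimes g$, i.e. $(\nabla_Xg)(Y,Z)=\theta(X)g(Y,Z)$ for all $X,Y,Z\in\Gamma(TM)$.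
   Formalization: The ''in particular'' clause is stated for n ≥ 1 and nonempty M: for n = 0 it fails, since a null line in the Minkowski plane has g = 0 and B = 0, so it is proper totally umbilical with λ = 1 and yet totally geodesic, hence Weyl. *)

(* Defs.v *)
From HB Require Import structures.
From mathcomp Require Import all_boot all_order all_algebra.
From mathcomp Require Import all_classical all_reals all_analysis.
Set Implicit Arguments.
Unset Strict Implicit.
Unset Printing Implicit Defensive.
Import Order.TTheory GRing.Theory Num.Theory.
Import numFieldNormedType.Exports.
Local Open Scope classical_set_scope.
Local Open Scope ring_scope.

(* C^k and C^oo on an open subset U of a normed space. *)
Fixpoint Ck (R : realType) (V W : normedModType R) (k : nat)
    (U : set V) (f : V -> W) : Prop :=
  if k is k'.+1 then
    (forall x, U x -> differentiable f x) /\
    (forall v : V, Ck k' U (fun x => 'D_v f x))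
  else forall x, U x -> {for x, continuous f}.

Definition smooth_on (R : realType) (V W : normedModType R)
    (U : set V) (f : V -> W) : Prop :=
  forall k, Ck k U f.

(* A chart is represented by total functions; coord is relevant on dom only
   and icoord, its inverse, on coord @` dom only. *)
Record chart (R : realType) (m : nat) (T : Type) := Chart {
  dom : set T;
  coord : T -> 'rV[R]_m;
  icoord : 'rV[R]_m -> T
}.

Definition is_chart (R : realType) (m : nat) (T : topologicalType)
    (c : chart R m T) : Prop :=
  [/\ open (dom c),
      open (coord c @` dom c),
      (forall x, dom c x -> {for x, continuous (coord c)}),
      (forall y, (coord c @` dom c) y -> {for y, continuous (icoord c)}) &
      (forall x, dom c x -> icoord c (coord c x) = x)].

(* The atlas need not be maximal. Each point x carries a preferred chart
   chart_at x. *)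
Record smoothManifold (R : realType) (m : nat) := SmoothManifold {
  carrier :> topologicalType;
  atlas : set (chart R m carrier);
  chart_at : carrier -> chart R m carrier;
  manifold_hausdorff : hausdorff_space carrier;
  manifold_second_countable : @second_countable carrier;
  atlas_chart : forall c, atlas c -> is_chart c;
  atlas_smooth : forall c c', atlas c -> atlas c' ->
    smooth_on (coord c @` (dom c `&` dom c')) (coord c' \o icoord c);
  chart_at_atlas : forall x, atlas (chart_at x);
  chart_at_dom : forall x, dom (chart_at x) x
}.

(* The tangent space at x is 'rV[R]_m: a tangent vector is given by its
   components in the coordinate basis of the preferred chart chart_at x.
   Hence comparing vectors at different points requires passing to components
   in one fixed chart c, which at x is v |-> v *m tcoord c x. Fields and
   sections are total functions; only their values on the open set under
   consideration matter. *)
Definition tcoord (R : realType) m (M : smoothManifold R m)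
    (c : chart R m M) (x : M) : 'M[R]_m :=
  'J (coord c \o icoord (chart_at x)) (coord (chart_at x) x).

(* The coordinate vector field d/dx_k of the chart c, on dom c. *)
Definition coord_field (R : realType) m (M : smoothManifold R m)
    (c : chart R m M) (k : 'I_m) (x : M) : 'rV[R]_m :=
  row k ('J (coord (chart_at x) \o icoord c) (coord c x)).

(* The matrix of the differential T_x M -> T_(f x) M', v |-> v *m tmap f x. *)
Definition tmap (R : realType) m m' (M : smoothManifold R m)
    (M' : smoothManifold R m') (f : M -> M') (x : M) : 'M[R]_(m, m') :=
  'J (coord (chart_at (f x)) \o f \o icoord (chart_at x))
     (coord (chart_at x) x).

(* v(f), for v a tangent vector at x. *)
Definition dirder (R : realType) m (M : smoothManifold R m)
    (V : normedModType R) (x : M) (v : 'rV[R]_m) (f : M -> V) : V :=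
  'D_v (f \o icoord (chart_at x)) (coord (chart_at x) x).

Definition smooth_fun (R : realType) m (M : smoothManifold R m)
    (V : normedModType R) (U : set M) (f : M -> V) : Prop :=
  forall c, atlas c -> smooth_on (coord c @` (U `&` dom c)) (f \o icoord c).

Definition smooth_map (R : realType) m m' (M : smoothManifold R m)
    (M' : smoothManifold R m') (f : M -> M') : Prop :=
  continuous f /\
  forall c', atlas c' -> smooth_fun (f @^-1` dom c') (coord c' \o f).

(* Y is a smooth section on U of the pull-back bundle f^* TM'. *)
Definition smooth_along (R : realType) m m' (M : smoothManifold R m)
    (M' : smoothManifold R m') (f : M -> M') (U : set M)
    (Y : M -> 'rV[R]_m') : Prop :=
  forall c', atlas c' ->
    smooth_fun (U `&` f @^-1` dom c') (fun x => Y x *m tcoord c' (f x)).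

Definition smooth_field (R : realType) m (M : smoothManifold R m)
    (U : set M) (X : M -> 'rV[R]_m) : Prop :=
  smooth_along (fun x : M => x) U X.

Definition smooth_1form (R : realType) m (M : smoothManifold R m)
    (theta : M -> 'cV[R]_m) : Prop :=
  forall U X, open U -> smooth_field U X ->
    smooth_fun U (fun x => (X x *m theta x) 0 0).

(* Smooth rank-k subbundle of f^* TM'; its fibre at x is the row space of E x.
   A distribution on M is the case f = id. *)
Definition subbundle_along (R : realType) m m' (M : smoothManifold R m)
    (M' : smoothManifold R m') (f : M -> M') (k : nat)
    (E : M -> 'M[R]_m') : Prop :=
  forall x, \rank (E x) = k /\
    exists (U : set M) (s : 'I_k -> M -> 'rV[R]_m'),
      [/\ open U, U x, (forall j, smooth_along f U (s j)) &
          forall y, U y -> (\matrix_(j < k) s j y :=: E y)%MS].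

Definition distribution (R : realType) m (M : smoothManifold R m) (k : nat)
    (E : M -> 'M[R]_m) : Prop :=
  subbundle_along (fun x : M => x) k E.

Definition coord_nbhd (R : realType) m (M : smoothManifold R m)
    (U : set M) : Prop :=
  open U /\ exists2 c, atlas c & U `<=` dom c.

(* Symmetric (0,2)-tensors are given by their Gram matrices. *)
Definition form (R : realType) m (G : 'M[R]_m) (v w : 'rV[R]_m) : R :=
  (v *m G *m w^T) 0 0.

Definition negdef_on (R : realType) m (G W : 'M[R]_m) : Prop :=
  forall v : 'rV[R]_m, (v <= W)%MS -> v != 0 -> form G v v < 0.

Definition has_index (R : realType) m (G : 'M[R]_m) (nu : nat) : Prop :=
  (exists2 W : 'M[R]_m, \rank W = nu & negdef_on G W) /\
  (forall W : 'M[R]_m, negdef_on G W -> (\rank W <= nu)%N).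

Definition pseudo_riemannian (R : realType) m (M : smoothManifold R m)
    (g : M -> 'M[R]_m) (nu : nat) : Prop :=
  [/\ (forall x, (g x)^T = g x),
      (forall x, g x \in unitmx),
      (forall x, has_index (g x) nu) &
      (forall U X Y, open U -> smooth_field U X -> smooth_field U Y ->
         smooth_fun U (fun x => form (g x) (X x) (Y x)))].

(* D x v Y stands for the covariant derivative of Y at x in the direction v. *)
Definition conn_op (R : realType) m (M : smoothManifold R m) : Type :=
  M -> 'rV[R]_m -> (M -> 'rV[R]_m) -> 'rV[R]_m.

(* The axioms are required for fields and functions smooth near x. Since f need
   only be smooth on U, the Leibniz rule for the indicator function of U shows
   that D x v Y depends only on the germ of Y at x. *)
Definition linear_connection (R : realType) m (M : smoothManifold R m)
    (D : conn_op M) : Prop :=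
  [/\ (forall U x Y, open U -> U x -> smooth_field U Y ->
         forall (a : R) v w, D x (a *: v + w) Y = a *: D x v Y + D x w Y),
      (forall U x Y Z, open U -> U x -> smooth_field U Y -> smooth_field U Z ->
         forall v, D x v (fun y => Y y + Z y) = D x v Y + D x v Z),
      (forall U x (f : M -> R) Y, open U -> U x ->
         smooth_fun U f -> smooth_field U Y ->
         forall v, D x v (fun y => f y *: Y y) =
                   dirder x v f *: Y x + f x *: D x v Y) &
      (forall U X Y, open U -> smooth_field U X -> smooth_field U Y ->
         smooth_field U (fun x => D x (X x) Y))].

(* [X, Y] at x, from its components X(Y^k) - Y(X^k) in the chart at x. *)
Definition lie_bracket (R : realType) m (M : smoothManifold R m)
    (X Y : M -> 'rV[R]_m) (x : M) : 'rV[R]_m :=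
  dirder x (X x) (fun y => Y y *m tcoord (chart_at x) y)
  - dirder x (Y x) (fun y => X y *m tcoord (chart_at x) y).

Definition torsion_free (R : realType) m (M : smoothManifold R m)
    (D : conn_op M) : Prop :=
  forall U X Y, open U -> smooth_field U X -> smooth_field U Y ->
    forall x, U x -> D x (X x) Y - D x (Y x) X = lie_bracket X Y x.

(* (nabla_v g)(Y, Z) at x. *)
Definition cov_metric (R : realType) m (M : smoothManifold R m)
    (g : M -> 'M[R]_m) (D : conn_op M) (x : M) (v : 'rV[R]_m)
    (Y Z : M -> 'rV[R]_m) : R :=
  dirder x v (fun y => form (g y) (Y y) (Z y))
  - form (g x) (D x v Y) (Z x) - form (g x) (Y x) (D x v Z).

Definition levi_civita (R : realType) m (M : smoothManifold R m)
    (g : M -> 'M[R]_m) (D : conn_op M) : Prop :=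
  [/\ linear_connection D, torsion_free D &
      forall U X Y Z, open U ->
        smooth_field U X -> smooth_field U Y -> smooth_field U Z ->
        forall x, U x -> cov_metric g D x (X x) Y Z = 0].

Definition weyl_connection (R : realType) m (M : smoothManifold R m)
    (g : M -> 'M[R]_m) (D : conn_op M) : Prop :=
  [/\ linear_connection D, torsion_free D &
      exists2 theta : M -> 'cV[R]_m, smooth_1form theta &
        forall U X Y Z, open U ->
          smooth_field U X -> smooth_field U Y -> smooth_field U Z ->
          forall x, U x ->
            cov_metric g D x (X x) Y Z =
            (X x *m theta x) 0 0 * form (g x) (Y x) (Z x)].

(* The derivative with respect to D, in the direction v tangent to M at x, of a
   section Y of f^* TM' (the pull-back of D): writing Y = \sum_k Y^k (e_k \o f)
   in the coordinate frame e_k of the chart at f x, it is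
   \sum_k v(Y^k) e_k + Y^k D_(df v) e_k. By definition of the tangent space at
   f x, the k-th component of a vector there is its k-th entry. *)
Definition cov_along (R : realType) m m' (M : smoothManifold R m)
    (M' : smoothManifold R m') (D : conn_op M') (f : M -> M')
    (x : M) (v : 'rV[R]_m) (Y : M -> 'rV[R]_m') : 'rV[R]_m' :=
  dirder x v (fun y => Y y *m tcoord (chart_at (f x)) (f y))
  + \sum_(k < m') Y x 0 k *:
      D (f x) (v *m tmap f x) (coord_field (chart_at (f x)) k).

Section Hypersurface.
Context (R : realType) (n : nat).
Context (Mbar : smoothManifold R n.+2) (gbar : Mbar -> 'M[R]_n.+2).
Context (Dbar : conn_op Mbar).
Context (M : smoothManifold R n.+1) (i : M -> Mbar).

Definition hypersurface : Prop :=
  [/\ smooth_map i, injective i & forall x, row_free (tmap i x)].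

Definition induced_metric (x : M) : 'M[R]_n.+1 :=
  tmap i x *m gbar (i x) *m (tmap i x)^T.

Definition lightlike : Prop := forall x, \rank (induced_metric x) = n.

(* The fibre T_x M^perp of the normal bundle, as a subspace of T_(i x) Mbar. *)
Definition normal_space (x : M) : 'M[R]_n.+2 :=
  kermx (gbar (i x) *m (tmap i x)^T).

Definition screen (S : M -> 'M[R]_n.+1) : Prop :=
  distribution n S /\
  forall x, (S x *m tmap i x :&: normal_space x)%MS = 0 /\
            (S x *m tmap i x + normal_space x :=: tmap i x)%MS.

Definition normal_section (U : set M) (xi : M -> 'rV[R]_n.+2) : Prop :=
  smooth_along i U xi /\
  forall x, U x -> xi x != 0 /\ (xi x <= normal_space x)%MS.

Definition transversal_section (S : M -> 'M[R]_n.+1) (tr : M -> 'M[R]_n.+2)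
    (U : set M) (xi N : M -> 'rV[R]_n.+2) : Prop :=
  smooth_along i U N /\
  forall x, U x ->
    [/\ (N x <= tr x)%MS,
        form (gbar (i x)) (N x) (xi x) = 1,
        form (gbar (i x)) (N x) (N x) = 0 &
        forall w : 'rV[R]_n.+1, (w <= S x)%MS ->
          form (gbar (i x)) (N x) (w *m tmap i x) = 0].

Definition transversal_bundle (S : M -> 'M[R]_n.+1) (tr : M -> 'M[R]_n.+2)
    : Prop :=
  subbundle_along i 1 tr /\
  forall U xi, coord_nbhd U -> normal_section U xi ->
    exists2 N, transversal_section S tr U xi N &
      forall N', transversal_section S tr U xi N' ->
        forall x, U x -> N' x = N x.

(* The projection T_(i x) Mbar -> T_x M along tr x; pinvmx (tmap i x) identifies
   the image of T_x M in T_(i x) Mbar with T_x M. *)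
Definition tangent_proj (tr : M -> 'M[R]_n.+2) (x : M) (w : 'rV[R]_n.+2)
    : 'rV[R]_n.+1 :=
  w *m proj_mx <<tmap i x>>%MS (tr x) *m pinvmx (tmap i x).

(* The Levi-Civita derivative of the tangent field Y of M. *)
Definition ambient_cov (x : M) (v : 'rV[R]_n.+1) (Y : M -> 'rV[R]_n.+1)
    : 'rV[R]_n.+2 :=
  cov_along Dbar i x v (fun y => Y y *m tmap i y).

Definition induced_connection (tr : M -> 'M[R]_n.+2) : conn_op M :=
  fun x v Y => tangent_proj tr x (ambient_cov x v Y).

Definition second_fundamental_form (tr : M -> 'M[R]_n.+2)
    (X Y : M -> 'rV[R]_n.+1) (x : M) : 'rV[R]_n.+2 :=
  ambient_cov x (X x) Y - induced_connection tr x (X x) Y *m tmap i x.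

Definition totally_geodesic (tr : M -> 'M[R]_n.+2) : Prop :=
  forall U X Y, open U -> smooth_field U X -> smooth_field U Y ->
    forall x, U x -> second_fundamental_form tr X Y x = 0.

(* B(X, Y), relative to the section xi of the normal bundle. *)
Definition local_second_form (xi : M -> 'rV[R]_n.+2)
    (X Y : M -> 'rV[R]_n.+1) (x : M) : R :=
  form (gbar (i x)) (ambient_cov x (X x) Y) (xi x).

Definition umbilical_factor (U : set M) (xi : M -> 'rV[R]_n.+2)
    (lambda : M -> R) : Prop :=
  smooth_fun U lambda /\
  forall X Y, smooth_field U X -> smooth_field U Y ->
    forall x, U x ->
      local_second_form xi X Y x =
      lambda x * form (induced_metric x) (X x) (Y x).

Definition proper_totally_umbilical : Prop :=
  forall U xi, coord_nbhd U -> normal_section U xi ->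
    exists2 lambda, umbilical_factor U xi lambda &
      forall x, U x -> lambda x != 0.

End Hypersurface.

(* Main.v *)
From Pilot Require Import Defs.
From HB Require Import structures.
From mathcomp Require Import all_boot all_order all_fingroup all_algebra ring.
From mathcomp Require Import all_classical all_reals all_analysis.
Import Order.TTheory GRing.Theory Num.Theory.
Import numFieldNormedType.Exports.
Import Pilot.Defs.
Set Implicit Arguments.
Unset Strict Implicit.
Unset Printing Implicit Defensive.
Local Open Scope classical_set_scope.
Local Open Scope ring_scope.

(** Write A for the differential of the immersion, xi for a normal vector and N
    for the vector of the transversal line with g(N, xi) = 1. For a tangent
    field Y the ambient derivative splits as D_v Y = nabla_v Y + B(v, Y) N, where
    B(v, Y) = g(D_v Y, xi) (lemma tangent_projE). As D is metric, this gives
      (nabla_v g)(Y, Z) = B(v, Y) g(N, Z) + B(v, Z) g(N, Y)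
    (lemma cov_metric_induced).

    If nabla is Weyl, the left side is theta(v) g(Y, Z), which vanishes as soon
    as Z = xi at the point considered: on a lightlike hypersurface xi is tangent
    and orthogonal to all tangent vectors. Taking Y = Z gives 2 B(v, xi) = 0,
    and then an arbitrary Y gives B(v, Y) = 0 (lemma weyl_totally_geodesic).
    Only the value of Z at the point matters, so xi need not be extended to a
    null field.

    Conversely, if B = 0 then nabla_v Y is the vector mapped by A to D_v Y. Since
    A is injective, nabla inherits the axioms of a connection and the absence of
    torsion from D, and nabla g = 0 (lemma totally_geodesic_weyl). In the proper
    umbilical case B = lambda g with lambda nowhere zero, so B = 0 would force
    g = 0, against its rank (lemma proper_umbilical_not_weyl).

    Most of the text supplies the calculus behind this. The derivative of a
    section along a map is independent of the chart used to compute it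
    (cov_along_chart), smooth (smooth_cov_along), compatible with the metric
    (metric_along) and, for a torsion-free connection, satisfies
    D_X (A Y) - D_Y (A X) = A [X, Y] (torsion_along). The latter rests on the
    symmetry of second derivatives (derive_comm). Finally, the transversal line
    is tied to xi only through smooth local normal sections, which have to be
    constructed (exists_normal_section). *)

(** * Germs of C^k maps between normed spaces *)

Section Germs.
Context (R : realType).
Implicit Types (U V W Z : normedModType R).

Lemma near_eq_differentiable V W (f g : V -> W) (p : V) :
  {near p, f =1 g} -> differentiable f p -> differentiable g p.
Proof.
move=> fg df.
have gE : g \o shift p = cst (g p) + 'd f p +o_ 0 id.
  apply/eqaddoP => e e0.
  have /eqaddoP/(_ e e0) := diff_locally df.
  have fg0 : \forall h \near (0 : V), f (h + p) = g (h + p).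
    by move: (fg); rewrite (near_shift 0 p (fun z => f z = g z)) subr0.
  rewrite -(nbhs_singleton fg).
  by apply: filterS2 fg0 => h /=; rewrite /shift !fctE /= => ->.
apply/diff_locallyP.
have dfg := @diff_unique _ _ _ g ('d f p) p (diff_continuous df) gE.
by split; rewrite dfg //; exact: diff_continuous.
Qed.

(** Unlike Ck, the conditions are required at all points near p; this makes the
    predicate depend only on the germ of f, and lets closure properties be
    proved at one point by induction on k. On open sets it agrees with Ck
    (Ck_on_at). *)
Fixpoint Ck_at V W (k : nat) (p : V) (f : V -> W) : Prop :=
  if k is k'.+1 then
    \forall q \near p, differentiable f q /\ forall v, Ck_at k' q ('D_v f)
  else \forall q \near p, {for q, continuous f}.

Definition smooth_at V W (p : V) (f : V -> W) : Prop := forall k, Ck_at k p f.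

Lemma Ck_at_near V W k (p : V) (f : V -> W) :
  Ck_at k p f -> \forall q \near p, Ck_at k q f.
Proof. by case: k => [|k] /= /nbhs_interior. Qed.

Lemma Ck_at_eq V W k (p : V) (f g : V -> W) :
  {near p, f =1 g} -> Ck_at k p f -> Ck_at k p g.
Proof.
elim: k p f g => [|k IH] p f g /nbhs_interior fg /= Hf.
  near=> q.
  have fq : {for q, continuous f} by near: q.
  have fgq : {near q, f =1 g} by near: q.
  rewrite /prop_for /continuous_at -(nbhs_singleton fgq).
  apply: cvg_trans fq; apply: near_eq_cvg.
  by apply: filterS fgq => z ->.
near=> q.
have [df Df] : differentiable f q /\ forall v, Ck_at k q ('D_v f) by near: q.
have fgq : {near q, f =1 g} by near: q.
split=> [|v]; first exact: near_eq_differentiable df.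
apply: IH (Df v).
by apply: filterS (nbhs_interior fgq) => z; exact: near_eq_derive.
Unshelve. all: by end_near. Qed.

(* the working introduction rule *)
(** Near p the derivatives may be replaced by any formula for them. Each closure
    property below is an induction on k through this rule, df being the rule of
    derivation for the operation at hand. *)
Lemma Ck_atS V W k (p : V) (f : V -> W) (df : V -> V -> W) :
  (\forall q \near p, [/\ differentiable f q, forall v, 'D_v f q = df v q &
     forall v, Ck_at k q (df v)]) -> Ck_at k.+1 p f.
Proof.
move=> /nbhs_interior H /=; near=> q.
have Hq : \forall q' \near q, [/\ differentiable f q',
  forall v, 'D_v f q' = df v q' & forall v, Ck_at k q' (df v)] by near: q.
have [d _ C] := nbhs_singleton Hq; split=> // v; apply: Ck_at_eq (C v).
by apply: filterS Hq => z [_ ->].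
Unshelve. all: by end_near. Qed.

Lemma Ck_at_continuous V W k (p : V) (f : V -> W) :
  Ck_at k p f -> {for p, continuous f}.
Proof.
by case: k => [|k] /nbhs_singleton //= -[/differentiable_continuous].
Qed.

Lemma Ck_atW V W k (p : V) (f : V -> W) : Ck_at k.+1 p f -> Ck_at k p f.
Proof.
elim: k p f => [|k IH] p f /= Hf.
  by apply: filterS Hf => q [/differentiable_continuous].
by apply: filterS Hf => q [? Df]; split=> // v; apply: IH; exact: Df.
Qed.

Lemma Ck_at_differentiable V W k (p : V) (f : V -> W) :
  Ck_at k.+1 p f -> differentiable f p.
Proof. by move=> /nbhs_singleton[]. Qed.

Lemma Ck_on_at V W k (U : set V) (f : V -> W) : open U ->
  Ck k U f <-> forall p, U p -> Ck_at k p f.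
Proof.
move=> oU; have nU p : U p -> \forall q \near p, U q.
  by move=> Up; apply: open_nbhs_nbhs.
elim: k f => [|k IH] f /=.
  split=> [H p Up|H p Up]; last by have := nbhs_singleton (H p Up).
  by apply: filterS (nU p Up).
split=> [[df Df] p Up|H].
  by apply: filterS (nU p Up) => q Uq; split=> [|v]; [exact: df|exact: (IH _).1].
split=> [p Up|v]; first by have [] := nbhs_singleton (H p Up).
by apply: (IH _).2 => p Up; have [_] := nbhs_singleton (H p Up); exact.
Qed.

Lemma Ck_at_cst V W k (p : V) (a : W) : Ck_at k p (fun=> a).
Proof.
elim: k p a => [|k IH] p a; first by apply: nearW => q; exact: cvg_cst.
apply: (@Ck_atS _ _ _ _ _ (fun _ _ => 0)); apply: nearW => q; split=> //.
by move=> v; exact: (derive_cst a q v).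
Qed.

Lemma Ck_at_add V W k (p : V) (f g : V -> W) :
  Ck_at k p f -> Ck_at k p g -> Ck_at k p (fun x => f x + g x).
Proof.
elim: k p f g => [|k IH] p f g /=.
  by apply: filterS2 => q fq gq; exact: cvgD fq gq.
move=> Hf Hg; apply: (@Ck_atS _ _ _ _ _ (fun v q => 'D_v f q + 'D_v g q)).
apply: filterS2 Hf Hg => q [df Df] [dg Dg]; split=> [|v|v].
- exact: differentiableD.
- by rewrite deriveD //; exact: diff_derivable.
- exact: IH.
Qed.

Lemma Ck_at_lin V W Z k (p : V) (L : {linear W -> Z}) (f : V -> W) :
  continuous L -> Ck_at k p f -> Ck_at k p (fun x => L (f x)).
Proof.
move=> cL; elim: k p f => [|k IH] p f /=.
  apply: filterS => q fq; exact: continuous_comp fq (cL _).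
move=> Hf; apply: (@Ck_atS _ _ _ _ _ (fun v q => L ('D_v f q))).
apply: filterS Hf => q [df Df].
have dL y : differentiable L y by exact: linear_differentiable.
split=> [|v|v].
- exact: differentiable_comp.
- rewrite deriveE; last exact: differentiable_comp.
  by rewrite diff_comp //= diff_lin // -deriveE.
- exact: IH.
Qed.

Lemma derive_bilin V U W Z (B : {bilinear U -> W -> Z}) (f : V -> U)
    (g : V -> W) (q v : V) :
  continuous (fun z => B z.1 z.2) -> differentiable f q -> differentiable g q ->
  differentiable (fun x => B (f x) (g x)) q /\
  'D_v (fun x => B (f x) (g x)) q = B ('D_v f q) (g q) + B (f q) ('D_v g q).
Proof.
move=> cB df dg.
have dB z : differentiable (fun z => B z.1 z.2) z by exact: differentiable_bilin.
have dfg : differentiable (fun y => (f y, g y)) q by exact: differentiable_pair.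
have dc : differentiable ((fun z => B z.1 z.2) \o (fun y => (f y, g y))) q.
  exact: differentiable_comp.
split; first exact: dc.
have -> : (fun x => B (f x) (g x)) = (fun z => B z.1 z.2) \o (fun y => (f y, g y)).
  by [].
by rewrite deriveE // diff_comp //= diff_bilin // diff_pair //= addrC -!deriveE.
Qed.

(** By the Leibniz rule, the derivatives of a product are sums of products of
    functions that are of class C^k again. Scaling and the matrix product are
    the cases of interest. *)
Lemma Ck_at_bilin V U W Z k (p : V) (B : {bilinear U -> W -> Z})
    (f : V -> U) (g : V -> W) :
  continuous (fun z => B z.1 z.2) ->
  Ck_at k p f -> Ck_at k p g -> Ck_at k p (fun x => B (f x) (g x)).
Proof.
move=> cB; elim: k p f g => [|k IH] p f g.
  move=> /=; apply: filterS2 => q fq gq.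
  exact: (@continuous2_cvg _ _ _ _ _ _ _ _ (fun a b => B a b) _ _ (cB (f q, g q)) fq gq).
move=> Hf Hg.
apply: (@Ck_atS _ _ _ _ _ (fun v q => B ('D_v f q) (g q) + B (f q) ('D_v g q))).
near=> q.
have Cf : Ck_at k.+1 q f by near: q; exact: Ck_at_near.
have Cg : Ck_at k.+1 q g by near: q; exact: Ck_at_near.
have [df Df] := nbhs_singleton Cf; have [dg Dg] := nbhs_singleton Cg.
split=> [|v|v].
- by case: (derive_bilin 0 cB df dg).
- by case: (derive_bilin v cB df dg).
- apply: Ck_at_add; apply: IH; [exact: Df|exact: Ck_atW Cg|exact: Ck_atW Cf|].
  exact: Dg.
Unshelve. all: by end_near. Qed.

End Germs.

Section MatrixGerms.
Context (R : realType).
Implicit Types (U V W Z : normedModType R).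

(** A bilinear structure is attached to a constant, hence a name for scaling. *)
Definition scale_by W (a : R^o) (w : W) : W := a *: w.

Lemma scale_by_is_bilinear W :
  bilinear_for
    (GRing.Scale.Law.clone _ _ *:%R _) (GRing.Scale.Law.clone _ _ *:%R _)
    (@scale_by W).
Proof.
by rewrite /scale_by; split=> [w|a] b x y /=;
  [rewrite scalerDl scalerA|rewrite scalerDr !scalerA mulrC].
Qed.
HB.instance Definition _ W := bilinear_isBilinear.Build R R^o W W _ _
  (@scale_by W) (@scale_by_is_bilinear W).

Lemma Ck_at_scale V W k (p : V) (f : V -> R) (g : V -> W) :
  Ck_at k p (f : V -> R^o) -> Ck_at k p g -> Ck_at k p (fun x => f x *: g x).
Proof.
by apply: (@Ck_at_bilin _ _ _ _ _ _ _ (@scale_by W)); exact: scale_continuous.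
Qed.

Lemma continuous_mx m n V (F : V -> 'M[R]_(m, n)) (p : V) :
  (forall i j, {for p, continuous (fun x => F x i j)}) -> {for p, continuous F}.
Proof.
move=> H; apply/cvg_ballP => e e0.
have : \forall x \near p, forall ij : 'I_m * 'I_n, ball (F p ij.1 ij.2) e (F x ij.1 ij.2).
  by apply: filter_forall => -[i j]; have /cvg_ballP := H i j; exact.
by apply: filterS => x Hx; split=> // i j; exact: (Hx (i, j)).
Qed.

Lemma mulmx_continuous m n q :
  continuous (fun z : 'M[R]_(m, n) * 'M[R]_(n, q) => z.1 *m z.2).
Proof.
move=> z; apply: continuous_mx => i j.
have -> : (fun x : 'M[R]_(m, n) * 'M[R]_(n, q) => (x.1 *m x.2) i j) =
    (fun x => \sum_l x.1 i l * x.2 l j) by apply/funext => x; rewrite mxE.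
apply: cvg_big => [|l _]; first exact: add_continuous.
apply: cvgM.
  exact: (continuous_comp (@cvg_fst _ _ _ _ _) (@coord_continuous _ _ _ i l _)).
exact: (continuous_comp (@cvg_snd _ _ _ _ _) (@coord_continuous _ _ _ l j _)).
Qed.

Lemma Ck_at_mul V m n q k (p : V) (F : V -> 'M[R]_(m, n)) (G : V -> 'M[R]_(n, q)) :
  Ck_at k p F -> Ck_at k p G -> Ck_at k p (fun x => F x *m G x).
Proof. exact: (Ck_at_bilin (@mulmx_continuous m n q)). Qed.

Lemma derive_mulmx V m n q (p v : V) (F : V -> 'M[R]_(m, n)) (G : V -> 'M[R]_(n, q)) :
  differentiable F p -> differentiable G p ->
  'D_v (fun x => F x *m G x) p = 'D_v F p *m G p + F p *m 'D_v G p.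
Proof.
by move=> dF dG; case: (derive_bilin v (@mulmx_continuous m n q) dF dG).
Qed.

Lemma derive_scale V W (p v : V) (f : V -> R) (g : V -> W) :
  differentiable f p -> differentiable g p ->
  'D_v (fun x => f x *: g x) p = 'D_v f p *: g p + f p *: 'D_v g p.
Proof.
by move=> df dg; case: (@derive_bilin _ _ _ _ _ (@scale_by W)
   f g p v (@scale_continuous _ _) df dg).
Qed.

Lemma Ck_at_sum V W k (p : V) (I : Type) (r : seq I) (P : pred I) (f : I -> V -> W) :
  (forall i, Ck_at k p (f i)) -> Ck_at k p (fun x => \sum_(i <- r | P i) f i x).
Proof.
move=> H; elim: r => [|i r IH].
  by apply: Ck_at_eq (Ck_at_cst k p 0); apply: nearW => x; rewrite big_nil.
have C : Ck_at k p (fun x => (if P i then f i x else 0) + \sum_(j <- r | P j) f j x).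
  by apply: Ck_at_add IH; case: (P i) => //; exact: Ck_at_cst.
apply: Ck_at_eq C; apply: nearW => x; rewrite big_cons.
by case: (P i); rewrite ?add0r.
Qed.

Lemma Ck_at_mx V m n k (p : V) (F : V -> 'M[R]_(m, n)) :
  (forall i j, Ck_at k p (fun x => F x i j)) -> Ck_at k p F.
Proof.
move=> H.
have C : Ck_at k p (fun x => \sum_i \sum_j F x i j *: delta_mx i j).
  do 2![apply: Ck_at_sum => ?]; apply: Ck_at_scale; first exact: H.
  exact: Ck_at_cst.
by apply: Ck_at_eq C; apply: nearW => x; rewrite -matrix_sum_delta.
Qed.

Lemma Ck_at_entry V m n k (p : V) (F : V -> 'M[R]_(m, n)) i j :
  Ck_at k p F -> Ck_at k p (fun x => F x i j).
Proof.
have @f : {linear 'M[R]_(m, n) -> R}.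
  by exists (fun N : 'M[R]_(_, _) => N i j); do 2![eexists]; do ?[constructor];
     rewrite ?mxE// => ? *; rewrite ?mxE//; move=> ?; rewrite !mxE.
by apply: (@Ck_at_lin _ _ _ _ _ _ f); exact: coord_continuous.
Qed.

(** As the source of f has a finite basis, the derivative of the composite along
    v is a finite sum: the partial derivatives of f, composed with phi, weighted
    by the components of the derivative of phi. *)
Lemma Ck_at_comp m W V k (p : V) (phi : V -> 'rV[R]_m) (f : 'rV[R]_m -> W) :
  Ck_at k p phi -> Ck_at k (phi p) f -> Ck_at k p (f \o phi).
Proof.
elim: k p phi f => [|k IH] p phi f Hphi Hf.
  near=> q.
  have cphi : {for q, continuous phi} by near: q.
  have cf : {for phi q, continuous f}.
    near: q; exact: (Ck_at_continuous Hphi Hf).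
  exact: continuous_comp cphi cf.
apply: (@Ck_atS _ _ _ _ _ _ (fun v q => \sum_j ('D_v phi q) 0 j *: 'D_(delta_mx 0 j) f (phi q))).
near=> q.
have Cphi : Ck_at k.+1 q phi by near: q; exact: Ck_at_near.
have Cf : Ck_at k.+1 (phi q) f.
  near: q; exact: (Ck_at_continuous Hphi (Ck_at_near Hf)).
have [dphi Dphi] := nbhs_singleton Cphi; have [df Df] := nbhs_singleton Cf.
split=> [|v|v].
- exact: differentiable_comp.
- rewrite deriveE; last exact: differentiable_comp.
  rewrite diff_comp //= -(deriveE _ dphi).
  rewrite [X in 'd f _ X]row_sum_delta linear_sum /=.
  by apply: eq_bigr => j _; rewrite linearZ /= (deriveE _ df).
- apply: Ck_at_sum => j; apply: Ck_at_scale.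
    apply: Ck_at_entry; exact: Dphi.
  by apply: (IH q phi ('D_(delta_mx 0 j) f)); [exact: Ck_atW Cphi|exact: Df].
Unshelve. all: by end_near. Qed.

Lemma Ck_at_inv V k (p : V) (f : V -> R^o) :
  f p != 0 -> Ck_at k p f -> Ck_at k p (fun x => (f x)^-1 : R^o).
Proof.
elim: k p => [|k IH] p fp0 Hf.
  have nz : \forall q \near p, f q != 0.
    have cf : f @ p --> f p := Ck_at_continuous Hf.
    exact: (cvgr_neq0 _ cf fp0).
  near=> q; apply: cvgV; near: q => //; exact: Hf.
have cf : f @ p --> f p := Ck_at_continuous Hf.
apply: (@Ck_atS _ _ _ _ _ _ (fun v q => ((- (f q)^-1 * (f q)^-1) : R^o) *: 'D_v f q)).
near=> q.
have Cf : Ck_at k.+1 q f by near: q; exact: Ck_at_near.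
have fq0 : f q != 0.
  by near: q; exact: (cvgr_neq0 _ cf fp0).
have [df Df] := nbhs_singleton Cf.
split=> [|v|v].
- exact: (@differentiableV _ _ f).
- rewrite (@deriveV _ _ f) //; last exact: diff_derivable.
  by rewrite mulNr -expr2 exprVn.
- apply: Ck_at_scale (Df v).
  have Ci := IH q fq0 (Ck_atW Cf).
  apply: (Ck_at_scale (g := fun q => (f q)^-1 : R^o)) => //.
  apply: (Ck_at_eq _ (Ck_at_scale (Ck_at_cst k q (-1 : R^o)) Ci)).
  by apply: nearW => x; rewrite scaleN1r.
Unshelve. all: by end_near. Qed.

Lemma smooth_at_derive V W (p v : V) (f : V -> W) :
  smooth_at p f -> smooth_at p ('D_v f).
Proof. by move=> Hf k; have [_] := nbhs_singleton (Hf k.+1); exact. Qed.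

Lemma smooth_at_differentiable V W (p : V) (f : V -> W) :
  smooth_at p f -> differentiable f p.
Proof. by move=> /(_ 1)/Ck_at_differentiable. Qed.

Lemma smooth_at_jacobian m n (p : 'rV[R]_m) (f : 'rV[R]_m -> 'rV[R]_n) :
  smooth_at p f -> smooth_at p (fun q => 'J f q).
Proof.
move=> Hf k; apply: Ck_at_mx => i j.
have C : Ck_at k p (fun q => 'D_(delta_mx 0 i) f q 0 j).
  by apply: Ck_at_entry; exact: smooth_at_derive.
apply: Ck_at_eq C; have : Ck_at 1 p f by [].
apply: filterS => q [df _].
by rewrite deriveEjacobian // -rowE mxE.
Qed.

End MatrixGerms.

Section Inverse.
Context (R : realType).
Implicit Types (V : normedModType R).

Lemma Ck_at_prod V k (p : V) (I : Type) (r : seq I) (P : pred I) (f : I -> V -> R^o) :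
  (forall i, Ck_at k p (f i)) ->
  Ck_at k p (fun x => (\prod_(i <- r | P i) f i x) : R^o).
Proof.
move=> H; elim: r => [|i r IH].
  by apply: Ck_at_eq (Ck_at_cst k p (1 : R^o)); apply: nearW => x; rewrite big_nil.
have C : Ck_at k p (fun x => (if P i then f i x else 1 : R^o) *:
    (\prod_(j <- r | P j) f j x : R^o)).
  by apply: Ck_at_scale IH; case: (P i) => //; exact: Ck_at_cst.
apply: Ck_at_eq C; apply: nearW => x; rewrite big_cons.
by case: (P i); rewrite ?scale1r.
Qed.

Lemma Ck_at_det V n k (p : V) (F : V -> 'M[R]_n) :
  Ck_at k p F -> Ck_at k p (fun x => \det (F x) : R^o).
Proof.
move=> CF; apply: (@Ck_at_sum _ V R^o k p _ _ _ (fun (s : {perm 'I_n}) (x : V) =>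
  ((-1) ^+ s * \prod_i F x i (s i)) : R^o)) => s.
apply: (@Ck_at_scale _ _ R^o _ _ (fun=> (-1) ^+ s : R^o)
  (fun x => \prod_i F x i (s i) : R^o)).
  exact: Ck_at_cst.
by apply: Ck_at_prod => i; exact: Ck_at_entry.
Qed.

(** Cramer's rule: the entries are polynomials in those of F, divided by the
    determinant. *)
Lemma Ck_at_invmx V n k (p : V) (F : V -> 'M[R]_n) :
  F p \in unitmx -> Ck_at k p F -> Ck_at k p (fun x => invmx (F x)).
Proof.
move=> Fp CF; have Cdet := Ck_at_det CF.
have dp0 : \det (F p) != 0 by rewrite -unitfE -unitmxE.
have nz : \forall q \near p, \det (F q) != 0.
  have cf : (fun x => \det (F x) : R^o) @ p --> \det (F p) := Ck_at_continuous Cdet.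
  exact: (cvgr_neq0 _ cf dp0).
have C : Ck_at k p (fun x => ((\det (F x))^-1 : R^o) *: \adj (F x)).
  apply: Ck_at_scale.
    exact: (@Ck_at_inv _ _ _ _ (fun x => \det (F x) : R^o) dp0 Cdet).
  apply: Ck_at_mx => i j.
  have Ccof : Ck_at k p (fun x => ((-1) ^+ (j + i) : R^o) *: (\det (row' j (col' i (F x))) : R^o)).
    apply: Ck_at_scale; first exact: Ck_at_cst.
    apply: Ck_at_det; apply: Ck_at_mx => a b.
    apply: Ck_at_eq (Ck_at_entry (lift j a) (lift i b) CF).
    by apply: nearW => x; rewrite !mxE.
  by apply: Ck_at_eq Ccof; apply: nearW => x; rewrite mxE /cofactor.
apply: Ck_at_eq C; apply: filterS nz => x dx.
by rewrite /invmx unitmxE unitfE dx.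
Qed.

End Inverse.

(** * Symmetry of second derivatives *)

Section Schwarz.
Context (R : realType) (V : normedModType R).
Implicit Types (f : V -> R) (p u v : V).

(** Both derivatives are limits of the same difference quotient. *)
Lemma is_derive_line f c u (s : R) : differentiable f (c + s *: u) ->
  is_derive s 1 (fun t : R => f (c + t *: u)) ('D_u f (c + s *: u)).
Proof.
move=> /(diff_derivable (v := u)) df.
have E : (fun h : R =>
    h^-1 *: (((fun t : R => f (c + t *: u)) \o shift s) (h *: 1) - f (c + s *: u))) =
  (fun h : R => h^-1 *: ((f \o shift (c + s *: u)) (h *: u) - f (c + s *: u))).
  apply/funext => h /=; congr (_ *: (f _ - _)).
  by rewrite /shift /= [h *: 1]mulr1 scalerDl addrCA addrA addrC addrA.
split; first by rewrite /derivable E.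
by rewrite {1}/derive E.
Qed.

(** The mean value theorem, first for s |-> f (p + s u + h v) - f (p + s u) and
    then for t |-> D_u f (p + s u + t v). *)
Lemma second_difference_mean_value f p u v (h : R) : 0 < h ->
  (forall s t : R, 0 <= s <= h -> 0 <= t <= h ->
    differentiable f (p + s *: u + t *: v) /\
    differentiable ('D_u f) (p + s *: u + t *: v)) ->
  exists s t : R, [/\ 0 <= s <= h, 0 <= t <= h &
    f (p + h *: u + h *: v) - f (p + h *: u) - f (p + h *: v) + f p =
    h * h * 'D_v ('D_u f) (p + s *: u + t *: v)].
Proof.
move=> h0 H.
have hh : 0 <= h <= h by rewrite lexx ltW.
have h00 : 0 <= (0 : R) <= h by rewrite lexx ltW.
have E t s : p + s *: u + t *: v = (p + t *: v) + s *: u by rewrite addrAC.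
pose g s := f (p + h *: v + s *: u) - f (p + s *: u).
have dg s : 0 <= s <= h ->
    is_derive s 1 g ('D_u f (p + h *: v + s *: u) - 'D_u f (p + s *: u)).
  move=> hs; apply: is_deriveB; apply: is_derive_line.
    by rewrite -E; have [] := H s h hs hh.
  by rewrite -[_ + _]addr0 -(scale0r v); have [] := H s 0 hs h00.
have inI (s : R) : s \in `]0, h[%R -> 0 <= s <= h.
  by rewrite in_itv /= => /andP[/ltW-> /ltW->].
have [|s s01 Es] := MVT h0 (fun s hs => dg s (inI s hs)).
  apply: derivable_within_continuous => s; rewrite in_itv /= => hs.
  exact: (@ex_derive _ _ _ _ _ _ _ (dg s hs)).
have hs := inI _ s01.
pose k t := 'D_u f (p + s *: u + t *: v).
have dk t : 0 <= t <= h -> is_derive t 1 k ('D_v ('D_u f) (p + s *: u + t *: v)).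
  by move=> ht; apply: is_derive_line; have [] := H s t hs ht.
have [|t t01 Et] := MVT h0 (fun t ht => dk t (inI t ht)).
  apply: derivable_within_continuous => t; rewrite in_itv /= => ht.
  exact: (@ex_derive _ _ _ _ _ _ _ (dk t ht)).
exists s, t; split=> //; first exact: inI.
have -> : f (p + h *: u + h *: v) - f (p + h *: u) - f (p + h *: v) + f p =
    g h - g 0 by rewrite /g !scale0r !addr0 E; ring.
rewrite Es !subr0; move: Et; rewrite /k scale0r addr0 subr0 -E => ->.
by ring.
Qed.

(** The second difference is symmetric in u and v, so for small h it is h^2 times
    a value near p of either mixed derivative; both are continuous at p. *)
Lemma derive_comm f p u v : Ck_at 2 p f -> 'D_u ('D_v f) p = 'D_v ('D_u f) p.
Proof.
move=> Hf; apply/eqP; rewrite -subr_eq0 -normr_eq0; apply/eqP/le_anti.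
rewrite normr_ge0 andbT; apply/ler_addgt0Pr => e e0; rewrite add0r.
have e2 : 0 < e / 2 by rewrite divr_gt0.
have Cuv a b : {for p, continuous ('D_a ('D_b f))}.
  have [_ /(_ b)/nbhs_singleton[_ /(_ a)]] := nbhs_singleton Hf.
  exact: (@Ck_at_continuous _ _ _ 0).
have near_ok a b : \forall z \near p, [/\ differentiable f z,
    differentiable ('D_b f) z & `|'D_a ('D_b f) p - 'D_a ('D_b f) z| < e / 2].
  near=> z.
  have [df /(_ b) Df] : differentiable f z /\ forall v, Ck_at 1 z ('D_v f).
    by near: z; exact: Hf.
  split=> //; first by have [] := nbhs_singleton Df.
  near: z; have /cvgrPdist_lt := Cuv a b; exact.
have /nbhs_ballP[r /= r0 Hr] : \forall z \near p,
    [/\ differentiable f z, differentiable ('D_u f) z, differentiable ('D_v f) z,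
      `|'D_u ('D_v f) p - 'D_u ('D_v f) z| < e / 2 &
      `|'D_v ('D_u f) p - 'D_v ('D_u f) z| < e / 2].
  by apply: filterS2 (near_ok u v) (near_ok v u) => z [? ? ?] [? ? ?]; split.
(* With this step p + s u + t v stays within r / 2 of p for s, t <= h. *)
pose h := r / (2 * (`|u| + `|v| + 1)).
have uv0 : 0 < `|u| + `|v| + 1 by rewrite ltr_wpDl // addr_ge0.
have h0 : 0 < h by rewrite divr_gt0 // mulr_gt0.
have inball a b s t : 0 <= s <= h -> 0 <= t <= h -> `|a| + `|b| = `|u| + `|v| ->
    ball p r (p + s *: a + t *: b).
  move=> /andP[s0 sh] /andP[t0 th] ab; rewrite -ball_normE /ball_ /=.
  rewrite -addrA opprD addrA subrr add0r normrN.
  apply: le_lt_trans (ler_normD _ _) _; rewrite !normrZ !ger0_norm //.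
  apply: (@le_lt_trans _ _ (h * (`|u| + `|v|))).
    by rewrite -ab mulrDr lerD // ler_wpM2r.
  have hr : h * (`|u| + `|v| + 1) = r / 2.
    by rewrite /h invfM mulrA -mulrA mulVf ?mulr1 // gt_eqF.
  apply: (@le_lt_trans _ _ (r / 2)); first by rewrite -hr ler_wpM2l ?(ltW h0) // lerDl ler01.
  by rewrite ltr_pdivrMr // ltr_pMr // ltr1n.
have [|s [t [hs ht Est]]] := @second_difference_mean_value f p u v h h0.
  by move=> s t hs ht; have [] := Hr _ (inball u v s t hs ht erefl).
have [|s' [t' [hs' ht' Est']]] := @second_difference_mean_value f p v u h h0.
  by move=> s' t' hs' ht'; have [] := Hr _ (inball v u s' t' hs' ht' (addrC _ _)).
have Ed : 'D_v ('D_u f) (p + s *: u + t *: v) = 'D_u ('D_v f) (p + s' *: v + t' *: u).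
  apply: (@mulfI _ (h * h)); first by rewrite mulf_neq0 // gt_eqF.
  have Ep : p + h *: v + h *: u = p + h *: u + h *: v by exact: addrAC.
  apply: (etrans (esym Est)); apply: etrans Est'; rewrite Ep; congr (_ + _).
  exact: addrAC.
have [_ _ _ _ Hvu] := Hr _ (inball u v s t hs ht erefl).
have [_ _ _ Huv _] := Hr _ (inball v u s' t' hs' ht' (addrC _ _)).
rewrite -(subrKA ('D_u ('D_v f) (p + s' *: v + t' *: u))).
apply: le_trans (ler_normD _ _) _; rewrite (splitr e); apply: lerD.
  exact: ltW Huv.
by rewrite -Ed distrC; exact: ltW Hvu.
Unshelve. all: by end_near. Qed.

End Schwarz.

Section Jacobian.
Context (R : realType).

Lemma jacobian_comp a b c (f : 'rV[R]_a -> 'rV[R]_b) (g : 'rV[R]_b -> 'rV[R]_c) p :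
  differentiable f p -> differentiable g (f p) ->
  'J (g \o f) p = 'J f p *m 'J g (f p).
Proof.
move=> df dg; apply/row_matrixP => i; rewrite !rowE mulmxA.
by rewrite /jacobian !mul_rV_lin1 diff_comp.
Qed.

Lemma near_eq_jacobian a b (f g : 'rV[R]_a -> 'rV[R]_b) p :
  {near p, f =1 g} -> differentiable f p -> 'J f p = 'J g p.
Proof.
move=> fg df; have dg := near_eq_differentiable fg df.
apply/row_matrixP => i; apply: (etrans (rowE _ _)); apply: (etrans _ (esym (rowE _ _))).
apply: (etrans (esym (deriveEjacobian _ df))).
apply: (etrans _ (deriveEjacobian _ dg)); exact: near_eq_derive.
Qed.

Lemma jacobian_id a (p : 'rV[R]_a) : 'J id p = 1%:M.
Proof.
apply/row_matrixP => i; rewrite !rowE mulmx1 -deriveEjacobian; last first.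
  exact: ex_diff.
exact: derive_id.
Qed.

Lemma derive_entry (V : normedModType R) a b (F : V -> 'M[R]_(a, b)) (p v : V) i j :
  differentiable F p -> ('D_v F p) i j = 'D_v (fun x => F x i j) p.
Proof. by move=> dF; rewrite derive_mx ?mxE //; exact: diff_derivable. Qed.

End Jacobian.

Lemma derive_comm_mx (R : realType) (V : normedModType R) a b (F : V -> 'M[R]_(a, b)) p u v :
  smooth_at p F -> 'D_v ('D_u F) p = 'D_u ('D_v F) p.
Proof.
move=> sF.
have Eij w i j : {near p, (fun q => ('D_w F q) i j) =1 'D_w (fun q => F q i j)}.
  have : Ck_at 1 p F by exact: sF.
  by apply: filterS => q [dF _]; exact: derive_entry.
apply/matrixP => i j.
have dD w : differentiable ('D_w F) p.
  by apply: smooth_at_differentiable; exact: smooth_at_derive.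
apply: (etrans (derive_entry v i j (dD u))).
apply: (etrans _ (esym (derive_entry u i j (dD v)))).
apply: (etrans (near_eq_derive v (Eij u i j))).
apply: (etrans _ (esym (near_eq_derive u (Eij v i j)))).
by apply: derive_comm; apply: Ck_at_entry; exact: sF.
Qed.

(** Both sides are mixed second derivatives of F along u and v. *)
Lemma hessian_sym (R : realType) a b (F : 'rV[R]_a -> 'rV[R]_b) p u v :
  smooth_at p F ->
  u *m 'D_v (fun q => 'J F q) p = v *m 'D_u (fun q => 'J F q) p.
Proof.
move=> sF; have dJ := smooth_at_differentiable (smooth_at_jacobian sF).
have E w z : z *m 'D_w (fun q => 'J F q) p = 'D_w ('D_z F) p.
  have dz : differentiable (fun=> z : 'rV[R]_a) p by exact: (differentiable_cst z p).
  have := derive_mulmx w dz dJ; rewrite (derive_cst z p w) mul0mx add0r => <-.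
  apply: near_eq_derive; have : Ck_at 1 p F by exact: sF.
  by apply: filterS => q [dF _]; apply/esym; exact: deriveEjacobian.
by apply: (etrans (E v u)); apply: (etrans _ (esym (E u v))); exact: derive_comm_mx.
Qed.

Lemma near_open (T : topologicalType) (p : T) (P : set T) :
  (\forall q \near p, P q) -> exists U, [/\ open U, U p & U `<=` P].
Proof.
by move=> H; exists P°; split; [exact: open_interior|exact: H|exact: interior_subset].
Qed.

(** * Smooth functions and maps on manifolds *)

Section Charts.
Context (R : realType) (m : nat) (M : smoothManifold R m).
Implicit Types (c d : chart R m M) (x y : M) (U : set M).

Lemma chartK c x : atlas c -> dom c x -> icoord c (coord c x) = x.
Proof. by move=> /atlas_chart[_ _ _ _]; exact. Qed.

Lemma icoord_chart_at x : icoord (chart_at x) (coord (chart_at x) x) = x.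
Proof. by apply: chartK; [exact: chart_at_atlas|exact: chart_at_dom]. Qed.

Lemma near_dom c x : atlas c -> dom c x -> \forall y \near x, dom c y.
Proof. by move=> /atlas_chart[oc _ _ _ _] cx; apply: open_nbhs_nbhs. Qed.

Lemma near_icoord c x (P : set M) : atlas c -> dom c x ->
  (\forall y \near x, P y) -> \forall z \near coord c x, P (icoord c z).
Proof.
move=> ac cx Px; have [_ _ _ ci _] := atlas_chart ac.
apply: (ci (coord c x)); first by exists x.
by rewrite chartK.
Qed.

Lemma near_coord c x (P : set 'rV[R]_m) : atlas c -> dom c x ->
  (\forall z \near coord c x, P z) -> \forall y \near x, P (coord c y).
Proof. by move=> /atlas_chart[_ _ cc _ _] cx; apply: cc. Qed.

Lemma near_icoordK c x : atlas c -> dom c x ->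
  \forall z \near coord c x, coord c (icoord c z) = z.
Proof.
move=> ac cx; have [_ oi _ _ K] := atlas_chart ac.
have : \forall z \near coord c x, (coord c @` dom c) z.
  by apply: open_nbhs_nbhs; split=> //; exists x.
by apply: filterS => _ [y cy <-]; rewrite K.
Qed.

Lemma open_coord_image c U : atlas c -> open U -> open (coord c @` (U `&` dom c)).
Proof.
move=> ac oU; rewrite openE => _ [x [Ux cx] <-].
have Ud : \forall y \near x, (U `&` dom c) y.
  by apply: filterS2 (open_nbhs_nbhs (conj oU Ux)) (near_dom ac cx).
rewrite /interior; have := near_icoord ac cx Ud.
by apply: filterS2 (near_icoordK ac cx) => z {2}<- Hz; exists (icoord c z).
Qed.

Lemma smooth_transition c d x : atlas c -> atlas d -> dom c x -> dom d x ->
  smooth_at (coord c x) (coord d \o icoord c).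
Proof.
move=> ac ad cx dx k; have [od _ _ _ _] := atlas_chart ad.
apply: (Ck_on_at k _ (open_coord_image ac od)).1; last by exists x.
by rewrite setIC; exact: atlas_smooth.
Qed.

(** The preferred chart is used, but any chart around x would do (msmooth_atP). *)
Definition msmooth_at (V : normedModType R) x (f : M -> V) : Prop :=
  smooth_at (coord (chart_at x) x) (f \o icoord (chart_at x)).

(** Passing from c to d composes with a transition map, which is smooth. *)
Lemma smooth_at_chart (V : normedModType R) c d x (f : M -> V) :
  atlas c -> atlas d -> dom c x -> dom d x ->
  smooth_at (coord c x) (f \o icoord c) -> smooth_at (coord d x) (f \o icoord d).
Proof.
move=> ac ad cx dx Hf k.
have C : Ck_at k (coord d x) ((f \o icoord c) \o (coord c \o icoord d)).
  by apply: Ck_at_comp; [exact: smooth_transition|rewrite /= chartK].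
apply: Ck_at_eq C; have := near_icoord ad dx (near_dom ac cx).
by apply: filterS => z cz /=; rewrite chartK.
Qed.

Lemma msmooth_atP (V : normedModType R) c x (f : M -> V) : atlas c -> dom c x ->
  msmooth_at x f <-> smooth_at (coord c x) (f \o icoord c).
Proof.
by move=> ac cx; split; apply: smooth_at_chart => //;
  [exact: chart_at_atlas|exact: chart_at_dom|exact: chart_at_atlas|exact: chart_at_dom].
Qed.

Lemma smooth_funP (V : normedModType R) U (f : M -> V) : open U ->
  smooth_fun U f <-> forall x, U x -> msmooth_at x f.
Proof.
move=> oU; split=> [Hf x Ux k|Hf c ac k].
  have [ac cx] := (chart_at_atlas x, chart_at_dom x).
  apply: (Ck_on_at k _ (open_coord_image ac oU)).1; first exact: Hf.
  by exists x.
apply: (Ck_on_at k _ (open_coord_image ac oU)).2 => _ [x [Ux cx] <-].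
exact: ((msmooth_atP _ ac cx).1 (Hf x Ux)).
Qed.

Lemma msmooth_at_eq (V : normedModType R) x (f g : M -> V) :
  {near x, f =1 g} -> msmooth_at x f -> msmooth_at x g.
Proof.
move=> fg Hf k; apply: Ck_at_eq (Hf k).
exact: (near_icoord (chart_at_atlas x) (chart_at_dom x) fg).
Qed.

Lemma msmooth_at_comp (V : normedModType R) a x (F : M -> 'rV[R]_a) (g : 'rV[R]_a -> V) :
  msmooth_at x F -> smooth_at (F x) g -> msmooth_at x (g \o F).
Proof.
move=> HF Hg k; apply: Ck_at_comp (HF k) _.
by rewrite /= icoord_chart_at.
Qed.

Lemma msmooth_at_cst (V : normedModType R) x (a : V) : msmooth_at x (fun=> a).
Proof. by move=> k; exact: Ck_at_cst. Qed.

Lemma msmooth_at_add (V : normedModType R) x (f g : M -> V) :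
  msmooth_at x f -> msmooth_at x g -> msmooth_at x (fun y => f y + g y).
Proof. by move=> Hf Hg k; exact: Ck_at_add (Hf k) (Hg k). Qed.

Lemma msmooth_at_scale (V : normedModType R) x (f : M -> R) (g : M -> V) :
  msmooth_at x f -> msmooth_at x g -> msmooth_at x (fun y => f y *: g y).
Proof. by move=> Hf Hg k; exact: Ck_at_scale (Hf k) (Hg k). Qed.

Lemma msmooth_at_mul a b e x (F : M -> 'M[R]_(a, b)) (G : M -> 'M[R]_(b, e)) :
  msmooth_at x F -> msmooth_at x G -> msmooth_at x (fun y => F y *m G y).
Proof. by move=> HF HG k; exact: Ck_at_mul (HF k) (HG k). Qed.

Lemma msmooth_at_mx a b x (F : M -> 'M[R]_(a, b)) :
  (forall i j, msmooth_at x (fun y => F y i j)) -> msmooth_at x F.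
Proof. by move=> HF k; apply: Ck_at_mx => i j; exact: HF. Qed.

Lemma msmooth_at_entry a b x (F : M -> 'M[R]_(a, b)) i j :
  msmooth_at x F -> msmooth_at x (fun y => F y i j).
Proof. by move=> HF k; exact: Ck_at_entry (HF k). Qed.

Lemma msmooth_at_tr a b x (F : M -> 'M[R]_(a, b)) :
  msmooth_at x F -> msmooth_at x (fun y => (F y)^T).
Proof.
move=> HF; apply: msmooth_at_mx => k l; apply: msmooth_at_eq (msmooth_at_entry l k HF).
by apply: nearW => y; rewrite [RHS]mxE.
Qed.

Lemma msmooth_at_sum (V : normedModType R) x n (f : 'I_n -> M -> V) :
  (forall i, msmooth_at x (f i)) -> msmooth_at x (fun y => \sum_i f i y).
Proof. by move=> Hf k; apply: Ck_at_sum => i; exact: Hf. Qed.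

Lemma msmooth_at_invmx a x (F : M -> 'M[R]_a) : F x \in unitmx ->
  msmooth_at x F -> msmooth_at x (fun y => invmx (F y)).
Proof.
move=> Fx HF k; apply: Ck_at_invmx (HF k).
by rewrite /= icoord_chart_at.
Qed.

Lemma msmooth_at_coord c x : atlas c -> dom c x -> msmooth_at x (coord c).
Proof.
by move=> ac cx; apply: smooth_transition => //; [exact: chart_at_atlas|exact: chart_at_dom].
Qed.

Lemma msmooth_at_continuous (V : normedModType R) x (f : M -> V) :
  msmooth_at x f -> {for x, continuous f}.
Proof.
move=> /(_ 0)/Ck_at_continuous cf A.
have [ac cx] := (chart_at_atlas x, chart_at_dom x).
rewrite -[f x]/(f x) -{1}(chartK ac cx) => /cf/(near_coord ac cx).
rewrite -!nearE. apply: filterS2 (near_dom ac cx) => y cy /=.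
by rewrite chartK.
Qed.

Lemma near_unitmx a x (F : M -> 'M[R]_a) : msmooth_at x F -> F x \in unitmx ->
  \forall y \near x, F y \in unitmx.
Proof.
move=> sF Fx.
have sd : msmooth_at x (fun y => \det (F y) : R^o) by move=> k; exact: Ck_at_det (sF k).
have cd : (fun y => \det (F y) : R^o) @ x --> \det (F x) := msmooth_at_continuous sd.
have d0 : \det (F x) != 0 by rewrite -unitfE -unitmxE.
by apply: filterS (cvgr_neq0 _ cd d0) => y; rewrite unitmxE unitfE.
Qed.

End Charts.

(** For the identity map this is the Jacobian of a change of charts. With some of
    the charts the preferred ones, tcoord and tmap are instances, and coord_field
    is a row of another. *)
Definition chart_jac (R : realType) m m' (M : smoothManifold R m)
  (M' : smoothManifold R m') (c : chart R m M) (c' : chart R m' M') (f : M -> M') (x : M) :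
  'M[R]_(m, m') := 'J (coord c' \o f \o icoord c) (coord c x).

Section Dirder.
Context (R : realType) (m : nat) (M : smoothManifold R m).
Implicit Types (V : normedModType R) (x : M) (v : 'rV[R]_m).

Lemma msmooth_differentiable V x (f : M -> V) : msmooth_at x f ->
  differentiable (f \o icoord (chart_at x)) (coord (chart_at x) x).
Proof. exact: smooth_at_differentiable. Qed.

Lemma dirder_eq V x v (f g : M -> V) : {near x, f =1 g} ->
  dirder x v f = dirder x v g.
Proof.
move=> fg; apply: near_eq_derive.
exact: (near_icoord (chart_at_atlas x) (chart_at_dom x) fg).
Qed.

Lemma dirder_cst V x v (a : V) : dirder x v (fun=> a) = 0.
Proof. exact: (derive_cst a _ v). Qed.

Lemma dirder_add V x v (f g : M -> V) : msmooth_at x f -> msmooth_at x g ->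
  dirder x v (fun y => f y + g y) = dirder x v f + dirder x v g.
Proof.
move=> /msmooth_differentiable df /msmooth_differentiable dg.
by rewrite /dirder -deriveD //; exact: diff_derivable.
Qed.

Lemma dirder_linear V x a v w (f : M -> V) : msmooth_at x f ->
  dirder x (a *: v + w) f = a *: dirder x v f + dirder x w f.
Proof.
by move=> /msmooth_differentiable df; rewrite /dirder !deriveE // linearP.
Qed.

Lemma dirder_mul a b c x v (F : M -> 'M[R]_(a, b)) (G : M -> 'M[R]_(b, c)) :
  msmooth_at x F -> msmooth_at x G ->
  dirder x v (fun y => F y *m G y) = dirder x v F *m G x + F x *m dirder x v G.
Proof.
move=> /msmooth_differentiable df /msmooth_differentiable dg.
have := derive_mulmx v df dg; rewrite /= icoord_chart_at; exact.
Qed.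

Lemma dirder_scale V x v (f : M -> R) (g : M -> V) :
  msmooth_at x f -> msmooth_at x g ->
  dirder x v (fun y => f y *: g y) = dirder x v f *: g x + f x *: dirder x v g.
Proof.
move=> /msmooth_differentiable df /msmooth_differentiable dg.
have := derive_scale v df dg; rewrite /= icoord_chart_at; exact.
Qed.

Lemma dirder_entry a b x v (F : M -> 'M[R]_(a, b)) i j : msmooth_at x F ->
  (dirder x v F) i j = dirder x v (fun y => F y i j).
Proof. by move=> /msmooth_differentiable df; rewrite /dirder derive_entry. Qed.

Lemma dirder_tr a b x v (F : M -> 'M[R]_(a, b)) : msmooth_at x F ->
  dirder x v (fun y => (F y)^T) = (dirder x v F)^T.
Proof.
move=> HF; apply/matrixP => i j; rewrite dirder_entry ?mxE.
  by rewrite dirder_entry //; apply: dirder_eq; apply: nearW => y; rewrite mxE.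
exact: msmooth_at_tr.
Qed.

End Dirder.

Section Maps.
Context (R : realType) (m m' : nat) (M : smoothManifold R m) (M' : smoothManifold R m').
Implicit Types (f : M -> M') (x : M).

Lemma smooth_map_near f x (P : set M') : smooth_map f ->
  (\forall y \near f x, P y) -> \forall y \near x, P (f y).
Proof. by move=> [cf _]; apply: cf. Qed.

Lemma smooth_map_coord f x (c' : chart R m' M') : smooth_map f -> atlas c' -> dom c' (f x) ->
  msmooth_at x (coord c' \o f).
Proof.
move=> [cf sf] ac' c'x; have [oc' _ _ _ _] := atlas_chart ac'.
have of' : open (f @^-1` dom c') by move/continuousP: cf; apply.
exact: ((smooth_funP _ of').1 (sf _ ac')).
Qed.

Lemma smooth_map_chart f x (c : chart R m M) (c' : chart R m' M') : smooth_map f ->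
  atlas c -> dom c x -> atlas c' -> dom c' (f x) ->
  smooth_at (coord c x) (coord c' \o f \o icoord c).
Proof.
move=> sf ac cx ac' c'x.
exact: (msmooth_atP _ ac cx).1 (smooth_map_coord sf ac' c'x).
Qed.

Lemma msmooth_at_pull (V : normedModType R) f x (g : M' -> V) : smooth_map f ->
  msmooth_at (f x) g -> msmooth_at x (g \o f).
Proof.
move=> sf Hg; have [ac cx] := (chart_at_atlas (f x), chart_at_dom (f x)).
have H := msmooth_at_comp (smooth_map_coord sf ac cx) Hg.
apply: msmooth_at_eq H; apply: filterS (smooth_map_near sf (near_dom ac cx)).
by move=> y cy /=; rewrite chartK.
Qed.

Lemma msmooth_chart_jac f x (c : chart R m M) (c' : chart R m' M') : smooth_map f ->
  atlas c -> dom c x -> atlas c' -> dom c' (f x) ->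
  msmooth_at x (chart_jac c c' f).
Proof.
move=> sf ac cx ac' c'x; apply/(msmooth_atP _ ac cx) => k.
have := smooth_at_jacobian (smooth_map_chart sf ac cx ac' c'x) k.
apply: Ck_at_eq; apply: filterS (near_icoordK ac cx) => z.
by rewrite /chart_jac /= => ->.
Qed.

Lemma dirder_pull (V : normedModType R) f x v (g : M' -> V) : smooth_map f ->
  msmooth_at (f x) g ->
  dirder x v (g \o f) = dirder (f x) (v *m tmap f x) g.
Proof.
move=> sf Hg; have [ac cx] := (chart_at_atlas x, chart_at_dom x).
have [ac' cx'] := (chart_at_atlas (f x), chart_at_dom (f x)).
pose F := coord (chart_at (f x)) \o f \o icoord (chart_at x).
have dF : differentiable F (coord (chart_at x) x).
  exact: smooth_at_differentiable (smooth_map_chart sf ac cx ac' cx').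
have EF : F (coord (chart_at x) x) = coord (chart_at (f x)) (f x).
  by rewrite /F /= chartK.
have dg : differentiable (g \o icoord (chart_at (f x))) (F (coord (chart_at x) x)).
  by rewrite EF; exact: msmooth_differentiable.
rewrite /dirder /tmap -deriveEjacobian // (deriveE _ dF) -EF (deriveE _ dg).
rewrite -[RHS]/(('d (g \o icoord (chart_at (f x))) (F (coord (chart_at x) x)) \o
   'd F (coord (chart_at x) x)) v) -diff_comp // -deriveE; last first.
  exact: differentiable_comp.
apply: near_eq_derive.
have := near_icoord ac cx (smooth_map_near sf (near_dom ac' cx')).
by apply: filterS => z cz; rewrite /F /= chartK.
Qed.

End Maps.

Lemma smooth_map_id (R : realType) m (M : smoothManifold R m) :
  smooth_map (fun x : M => x).
Proof.
split=> [x|c' ac']; first exact: cvg_id.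
have [oc' _ _ _ _] := atlas_chart ac'.
by apply: ((smooth_funP _ oc').2) => x cx; exact: msmooth_at_coord.
Qed.

(** Besides the chain rule, this contains (with identity maps) the cocycle rule
    for changes of charts, and their effect on the differential of a map. *)
Lemma chart_jac_comp (R : realType) m1 m2 m3 (M1 : smoothManifold R m1)
  (M2 : smoothManifold R m2) (M3 : smoothManifold R m3)
  (c1 : chart R m1 M1) (c2 : chart R m2 M2) (c3 : chart R m3 M3)
  (f : M1 -> M2) (g : M2 -> M3) x :
  smooth_map f -> smooth_map g -> atlas c1 -> dom c1 x -> atlas c2 -> dom c2 (f x) ->
  atlas c3 -> dom c3 (g (f x)) ->
  chart_jac c1 c2 f x *m chart_jac c2 c3 g (f x) = chart_jac c1 c3 (g \o f) x.
Proof.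
move=> sf sg a1 d1 a2 d2 a3 d3.
have dF := smooth_at_differentiable (smooth_map_chart sf a1 d1 a2 d2).
pose F := coord c2 \o f \o icoord c1; pose G := coord c3 \o g \o icoord c2.
have E : F (coord c1 x) = coord c2 (f x) by rewrite /F /= chartK.
have dG : differentiable G (F (coord c1 x)).
  by rewrite E; exact: smooth_at_differentiable (smooth_map_chart sg a2 d2 a3 d3).
have J : 'J (G \o F) (coord c1 x) = 'J F (coord c1 x) *m 'J G (coord c2 (f x)).
  by rewrite -E; exact: jacobian_comp.
apply: (etrans (esym J)).
apply: near_eq_jacobian; last exact: differentiable_comp.
have := near_icoord a1 d1 (smooth_map_near sf (near_dom a2 d2)).
by apply: filterS => z cz; rewrite /F /G /= chartK.
Qed.

Lemma chart_jac_id (R : realType) m (M : smoothManifold R m) (c : chart R m M) x :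
  atlas c -> dom c x -> chart_jac c c (fun y => y) x = 1%:M.
Proof.
move=> ac cx; rewrite /chart_jac -(jacobian_id (coord c x)); apply: near_eq_jacobian.
  exact: near_icoordK.
exact: smooth_at_differentiable (smooth_map_chart (@smooth_map_id _ _ M) ac cx ac cx).
Qed.

(** * Coordinate frames and fields along a map *)

Section Frames.
Context (R : realType) (m : nat) (M : smoothManifold R m).
Implicit Types (c d : chart R m M) (x y : M).

(** The inverse of tcoord c x: its rows are the coordinate vectors of c. *)
Definition frame c x : 'M[R]_m := chart_jac c (chart_at x) (fun y => y) x.

Lemma coord_fieldE c k x : coord_field c k x = row k (frame c x).
Proof. by []. Qed.

Lemma tcoordE c x : tcoord c x = chart_jac (chart_at x) c (fun y => y) x.
Proof. by []. Qed.

Lemma transition_comp c d e x : atlas c -> dom c x -> atlas d -> dom d x ->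
  atlas e -> dom e x ->
  chart_jac c d (fun y => y) x *m chart_jac d e (fun y => y) x =
  chart_jac c e (fun y => y) x.
Proof.
move=> ac cx ad dx ae ex.
exact: (chart_jac_comp (@smooth_map_id _ _ M) (@smooth_map_id _ _ M)).
Qed.

Lemma frame_tcoord c x : atlas c -> dom c x -> frame c x *m tcoord c x = 1%:M.
Proof.
move=> ac cx; have [ax dx] := (chart_at_atlas x, chart_at_dom x).
by rewrite tcoordE /frame transition_comp // chart_jac_id.
Qed.

Lemma tcoord_frame c x : atlas c -> dom c x -> tcoord c x *m frame c x = 1%:M.
Proof.
move=> ac cx; have [ax dx] := (chart_at_atlas x, chart_at_dom x).
by rewrite tcoordE /frame transition_comp // chart_jac_id.
Qed.

Lemma tcoord_chart_at x : tcoord (chart_at x) x = 1%:M.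
Proof. by rewrite tcoordE chart_jac_id; [|exact: chart_at_atlas|exact: chart_at_dom]. Qed.

Lemma frame_chart_at x : frame (chart_at x) x = 1%:M.
Proof. by rewrite /frame chart_jac_id; [|exact: chart_at_atlas|exact: chart_at_dom]. Qed.

Lemma tcoord_transition c d x : atlas c -> dom c x -> atlas d -> dom d x ->
  tcoord c x *m chart_jac c d (fun y => y) x = tcoord d x.
Proof.
move=> ac cx ad dx; rewrite !tcoordE transition_comp //.
  exact: chart_at_atlas.
exact: chart_at_dom.
Qed.

Lemma transition_frame c d x : atlas c -> dom c x -> atlas d -> dom d x ->
  chart_jac c d (fun y => y) x *m frame d x = frame c x.
Proof.
move=> ac cx ad dx; rewrite /frame transition_comp //.
  exact: chart_at_atlas.
exact: chart_at_dom.
Qed.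

End Frames.

Section Along.
Context (R : realType) (m m' : nat) (M : smoothManifold R m) (M' : smoothManifold R m').
Context (f : M -> M') (sf : smooth_map f).
Implicit Types (x y : M) (Y Z : M -> 'rV[R]_m') (e : chart R m' M').

(** The chart is fixed while y varies, in contrast to the components Y y, which
    refer to the chart at f y. *)
Definition smooth_along_at x Y : Prop :=
  msmooth_at x (fun y => Y y *m tcoord (chart_at (f x)) (f y)).

(** Components in two charts differ by the Jacobian of the change of charts,
    which is smooth. *)
Lemma smooth_along_at_chart2 e e2 x Y : atlas e -> dom e (f x) -> atlas e2 -> dom e2 (f x) ->
  msmooth_at x (fun y => Y y *m tcoord e (f y)) ->
  msmooth_at x (fun y => Y y *m tcoord e2 (f y)).
Proof.
move=> ac cx ad dx HY.
have Hj : msmooth_at x (chart_jac e e2 (fun q => q) \o f).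
  by apply: (msmooth_at_pull sf); apply: msmooth_chart_jac => //; exact: smooth_map_id.
apply: msmooth_at_eq (msmooth_at_mul HY Hj).
have := smooth_map_near sf (near_dom ac cx).
apply: filterS2 (smooth_map_near sf (near_dom ad dx)) => y dy cy.
by rewrite -mulmxA tcoord_transition.
Qed.

Lemma smooth_along_at_chart e x Y : atlas e -> dom e (f x) ->
  smooth_along_at x Y <-> msmooth_at x (fun y => Y y *m tcoord e (f y)).
Proof.
move=> ac cx; have [ap dp] := (chart_at_atlas (f x), chart_at_dom (f x)).
by split; exact: smooth_along_at_chart2.
Qed.

Lemma smooth_alongP U Y : open U ->
  smooth_along f U Y <-> forall x, U x -> smooth_along_at x Y.
Proof.
move=> oU; have [cf _] := sf.
have oV e : atlas e -> open (U `&` f @^-1` dom e).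
  move=> /atlas_chart[oc' _ _ _ _]; apply: openI => //.
  by move/continuousP: cf; apply.
split=> [H x Ux|H e ac'].
  have ac := chart_at_atlas (f x).
  exact: ((smooth_funP _ (oV _ ac)).1 (H _ ac) x (conj Ux (chart_at_dom (f x)))).
apply: ((smooth_funP _ (oV _ ac')).2) => x [Ux cx].
exact: ((smooth_along_at_chart _ ac' cx).1 (H x Ux)).
Qed.

Lemma smooth_along_at_eq x Y Z : {near x, Y =1 Z} ->
  smooth_along_at x Y -> smooth_along_at x Z.
Proof. by move=> YZ; apply: msmooth_at_eq; apply: filterS YZ => y ->. Qed.

Lemma smooth_along_at_add x Y Z : smooth_along_at x Y -> smooth_along_at x Z ->
  smooth_along_at x (fun y => Y y + Z y).
Proof.
move=> HY HZ; apply: msmooth_at_eq (msmooth_at_add HY HZ).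
by apply: nearW => y; rewrite mulmxDl.
Qed.

Lemma smooth_along_at_scale x (a : M -> R) Y : msmooth_at x a -> smooth_along_at x Y ->
  smooth_along_at x (fun y => a y *: Y y).
Proof.
move=> Ha HY; apply: msmooth_at_eq (msmooth_at_scale Ha HY).
by apply: nearW => y; rewrite scalemxAl.
Qed.

Lemma smooth_along_at_sum x n (Y : 'I_n -> M -> 'rV[R]_m') :
  (forall k, smooth_along_at x (Y k)) -> smooth_along_at x (fun y => \sum_k Y k y).
Proof.
move=> HY; apply: msmooth_at_eq (msmooth_at_sum HY).
by apply: nearW => y; rewrite mulmx_suml.
Qed.

Lemma smooth_along_at_frame e x (a : M -> 'rV[R]_m') : atlas e -> dom e (f x) ->
  msmooth_at x a -> smooth_along_at x (fun y => a y *m frame e (f y)).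
Proof.
move=> ac cx Ha; apply/(smooth_along_at_chart _ ac cx).
apply: msmooth_at_eq Ha; apply: filterS (smooth_map_near sf (near_dom ac cx)) => y cy.
by rewrite -mulmxA frame_tcoord // mulmx1.
Qed.

End Along.

Section Fields.
Context (R : realType) (m : nat) (M : smoothManifold R m).
Implicit Types (x y : M) (X Y : M -> 'rV[R]_m) (c : chart R m M).

Definition smooth_field_at x X := smooth_along_at (fun y : M => y) x X.

Lemma smooth_fieldP U X : open U -> smooth_field U X <-> forall x, U x -> smooth_field_at x X.
Proof. exact: (smooth_alongP (@smooth_map_id _ _ M)). Qed.

Lemma smooth_fieldS U V X : open U -> open V -> U `<=` V ->
  smooth_field V X -> smooth_field U X.
Proof.
move=> oU oV UV sX; apply/(smooth_fieldP _ oU) => y /UV.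
exact: ((smooth_fieldP _ oV).1 sX).
Qed.

Lemma smooth_const_field c x (a : 'rV[R]_m) : atlas c -> dom c x ->
  smooth_field_at x (fun y => a *m frame c y).
Proof.
move=> ac cx.
apply: (smooth_along_at_frame (@smooth_map_id _ _ M) (a := fun=> a) ac cx).
exact: msmooth_at_cst.
Qed.

Lemma smooth_coord_field c k x : atlas c -> dom c x -> smooth_field_at x (coord_field c k).
Proof.
move=> ac cx; apply: smooth_along_at_eq (smooth_const_field (delta_mx 0 k) ac cx).
by apply: nearW => y; rewrite coord_fieldE rowE.
Qed.

(** The field with constant components in the chart at x, whose frame is the
    identity at x. *)
Lemma field_through x (a : 'rV[R]_m) : exists U X,
  [/\ open U, U x, coord_nbhd U, smooth_field U X & X x = a].
Proof.
have [ac cx] := (chart_at_atlas x, chart_at_dom x).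
have [oc _ _ _ _] := atlas_chart ac.
exists (dom (chart_at x)), (fun y => a *m frame (chart_at x) y); split=> //.
- by split=> //; exists (chart_at x).
- by apply/(smooth_fieldP _ oc) => y cy; exact: smooth_const_field.
- by rewrite frame_chart_at mulmx1.
Qed.

(** The chart in which dirder is defined changes with x; to differentiate along
    a field, one chart is needed for all points. *)
Lemma dirder_chart (V : normedModType R) c x v (F : M -> V) : atlas c -> dom c x ->
  msmooth_at x F ->
  dirder x v F = 'D_(v *m tcoord c x) (F \o icoord c) (coord c x).
Proof.
move=> ac cx HF; have [ax dx] := (chart_at_atlas x, chart_at_dom x).
pose h := coord c \o icoord (chart_at x); pose g := F \o icoord c.
have dh : differentiable h (coord (chart_at x) x).
  exact: smooth_at_differentiable (smooth_transition ax ac dx cx).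
have Eh : h (coord (chart_at x) x) = coord c x by rewrite /h /= chartK.
have dg : differentiable g (h (coord (chart_at x) x)).
  by rewrite Eh; apply: smooth_at_differentiable; apply/msmooth_atP.
have E : dirder x v F = 'D_v (g \o h) (coord (chart_at x) x).
  apply: near_eq_derive; apply: filterS (near_icoord ax dx (near_dom ac cx)) => z cz.
  by rewrite /g /h /= chartK.
apply: (etrans E); rewrite deriveE; last exact: differentiable_comp.
rewrite diff_comp //=; rewrite -Eh.
rewrite [RHS](deriveE _ dg); congr ('d g _ _).
by rewrite -(deriveE _ dh) (deriveEjacobian _ dh).
Qed.

(** In a fixed chart the derivative along X is a combination of partial
    derivatives, with the components of X as coefficients. *)
Lemma msmooth_dirder a b x X (F : M -> 'M[R]_(a, b)) : smooth_field_at x X ->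
  (\forall y \near x, msmooth_at y F) -> msmooth_at x (fun y => dirder y (X y) F).
Proof.
move=> HX HF; have [ac cx] := (chart_at_atlas x, chart_at_dom x).
set c := chart_at x in ac cx.
have H : msmooth_at x (fun y => \sum_j (X y *m tcoord c y) 0 j *:
   (('D_(delta_mx 0 j) (F \o icoord c)) \o coord c) y).
  apply: msmooth_at_sum => j; apply: msmooth_at_scale.
    exact: msmooth_at_entry.
  apply: (@msmooth_at_comp _ _ _ _ _ _ (coord c)); first exact: msmooth_at_coord.
  apply: smooth_at_derive; apply/(msmooth_atP _ ac cx); exact: nbhs_singleton HF.
apply: msmooth_at_eq H; apply: filterS2 HF (near_dom ac cx) => y HF cy.
have d : differentiable (F \o icoord c) (coord c y).
  by apply: smooth_at_differentiable; apply/(msmooth_atP _ ac cy).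
rewrite (dirder_chart _ ac cy) // (deriveE _ d).
rewrite [X in 'd _ _ X]row_sum_delta linear_sum /=; apply: eq_bigr => j _.
by rewrite linearZ /= (deriveE _ d).
Qed.

End Fields.

Section Push.
Context (R : realType) (m m' : nat) (M : smoothManifold R m) (M' : smoothManifold R m').
Context (f : M -> M') (sf : smooth_map f).
Implicit Types (x y : M) (X : M -> 'rV[R]_m) (c : chart R m M) (e : chart R m' M').

(** Both sides are the Jacobian of f from the chart at x to e. *)
Lemma tmap_tcoord c e x : atlas c -> dom c x -> atlas e -> dom e (f x) ->
  tmap f x *m tcoord e (f x) = tcoord c x *m chart_jac c e f x.
Proof.
move=> ac cx ac' cx'.
have [ax dx] := (chart_at_atlas x, chart_at_dom x).
have [ap dp] := (chart_at_atlas (f x), chart_at_dom (f x)).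
have E1 := chart_jac_comp sf (@smooth_map_id _ _ M') ax dx ap dp ac' cx'.
have E2 := chart_jac_comp (@smooth_map_id _ _ M) sf ax dx ac cx ac' cx'.
exact: etrans E1 (esym E2).
Qed.

Lemma smooth_push x X : smooth_field_at x X ->
  smooth_along_at f x (fun y => X y *m tmap f y).
Proof.
move=> HX.
have [ax dx] := (chart_at_atlas x, chart_at_dom x).
have [ap dp] := (chart_at_atlas (f x), chart_at_dom (f x)).
apply: msmooth_at_eq (msmooth_at_mul HX (msmooth_chart_jac sf ax dx ap dp)).
apply: filterS2 (near_dom ax dx) (smooth_map_near sf (near_dom ap dp)) => y dy dfy.
by rewrite -!mulmxA (tmap_tcoord ax dy ap dfy).
Qed.

End Push.

(** Let J be the Jacobian of f in fixed charts and C a constant matrix with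
    J C = 1 at x. Near x, J C is invertible, and the components of Z are those
    of its image times C (J C)^-1. *)
Lemma smooth_push_inv (R : realType) m m' (M : smoothManifold R m)
    (M' : smoothManifold R m') (f : M -> M') x (Z : M -> 'rV[R]_m) :
  smooth_map f -> row_free (tmap f x) ->
  smooth_along_at f x (fun y => Z y *m tmap f y) -> smooth_field_at x Z.
Proof.
move=> sf /row_freeP[C PC] sW; set c := chart_at x; set e := chart_at (f x).
have ac : atlas c by exact: chart_at_atlas.
have cx : dom c x by exact: chart_at_dom.
have ae : atlas e by exact: chart_at_atlas.
have ex : dom e (f x) by exact: chart_at_dom.
have sJC := msmooth_at_mul (msmooth_chart_jac sf ac cx ae ex) (msmooth_at_cst x C).
have uJC : chart_jac c e f x *m C \in unitmx.
  by rewrite [_ *m C]PC unitmx1.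
have H := msmooth_at_mul (msmooth_at_mul sW (msmooth_at_cst x C)) (msmooth_at_invmx uJC sJC).
apply: msmooth_at_eq H.
apply: filterS2 (near_unitmx sJC uJC)
  (filterI (near_dom ac cx) (smooth_map_near sf (near_dom ae ex))) => y uy [cy ey].
have algebra (z : 'rV[R]_m) (P J : 'M[R]_(m, m')) T T' : P *m T' = T *m J ->
    J *m C \in unitmx -> z *m P *m T' *m C *m invmx (J *m C) = z *m T.
  by move=> E u; rewrite -[z *m P *m T']mulmxA E -!mulmxA [J *m (C *m _)]mulmxA mulmxV ?mulmx1.
exact: algebra (tmap_tcoord sf ac cy ae ey) uy.
Qed.

(** * Linear connections and their pull-back along a map *)

Section Connection.
Context (R : realType) (m : nat) (M : smoothManifold R m).
Context (D : conn_op M) (HD : linear_connection D).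
Implicit Types (p q : M) (X Y Z : M -> 'rV[R]_m) (v w : 'rV[R]_m) (c : chart R m M).

(** Smoothness at p lets the neighbourhood shrink with the order of
    differentiation, whereas the axioms of a connection ask for a single one. *)
Definition smooth_field_near p Y := \forall q \near p, smooth_field_at q Y.

Lemma smooth_field_nearI U p Y : open U -> U p -> smooth_field U Y -> smooth_field_near p Y.
Proof.
move=> oU Up sY; apply: filterS (open_nbhs_nbhs (conj oU Up)).
exact: ((smooth_fieldP _ oU).1 sY).
Qed.

Lemma smooth_field_nearP p Y : smooth_field_near p Y ->
  exists U, [/\ open U, U p & smooth_field U Y].
Proof.
by move=> /near_open[U [oU Up UY]]; exists U; split=> //; apply/smooth_fieldP.
Qed.

Lemma smooth_field_near2P p Y Z : smooth_field_near p Y -> smooth_field_near p Z ->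
  exists U, [/\ open U, U p, smooth_field U Y & smooth_field U Z].
Proof.
move=> HY HZ; have [U [oU Up UYZ]] := near_open (filterI HY HZ).
by exists U; split=> //; apply/smooth_fieldP => // q /UYZ[].
Qed.

Lemma conn_linear p a v w Y : smooth_field_near p Y ->
  D p (a *: v + w) Y = a *: D p v Y + D p w Y.
Proof. by move=> /smooth_field_nearP[U [oU Up sY]]; case: HD => H _ _ _; apply: H sY _ _ _. Qed.

Lemma conn_add p v Y Z : smooth_field_near p Y -> smooth_field_near p Z ->
  D p v (fun q => Y q + Z q) = D p v Y + D p v Z.
Proof.
move=> HY HZ; have [U [oU Up sY sZ]] := smooth_field_near2P HY HZ.
by case: HD => _ H _ _; apply: (H U).
Qed.

Lemma conn_scale p v (a : M -> R) Y : (\forall q \near p, msmooth_at q a) ->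
  smooth_field_near p Y ->
  D p v (fun q => a q *: Y q) = dirder p v a *: Y p + a p *: D p v Y.
Proof.
move=> Ha HY; have [U [oU Up UaY]] := near_open (filterI Ha HY).
case: HD => _ _ H _; apply: (H U) => //.
  by apply/(smooth_funP _ oU) => q /UaY[].
by apply/(smooth_fieldP _ oU) => q /UaY[].
Qed.

(** Multiply both fields by the indicator function a of a neighbourhood U on
    which they agree: a Y = a Z everywhere, and as a is 1 near p, the Leibniz
    rule gives D (a Y) = D Y and D (a Z) = D Z at p. *)
Lemma conn_near_eq p v Y Z : smooth_field_near p Y -> {near p, Y =1 Z} ->
  D p v Y = D p v Z.
Proof.
move=> HY YZ; have [U [oU Up UYZ]] := near_open (filterI HY YZ).
pose a q : R := if `[< U q >] then 1 else 0.
have Ua q : U q -> {near q, (fun=> 1) =1 a}.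
  move=> Uq; have := open_nbhs_nbhs (conj oU Uq).
  by apply: filterS => z Uz; rewrite /a; case: asboolP.
have sa : smooth_fun U a.
  apply/(smooth_funP _ oU) => q Uq; apply: msmooth_at_eq (Ua q Uq) _.
  exact: msmooth_at_cst.
have sY : smooth_field U Y by apply/(smooth_fieldP _ oU) => q /UYZ[].
have sZ : smooth_field U Z.
  apply/(smooth_fieldP _ oU) => q Uq; have [HYq _] := UYZ q Uq.
  apply: smooth_along_at_eq HYq.
  by apply: filterS (open_nbhs_nbhs (conj oU Uq)) => z /UYZ[].
have E : (fun q => a q *: Y q) = (fun q => a q *: Z q).
  apply/funext => q; rewrite /a; case: asboolP => [/UYZ[_ ->]//|_].
  by rewrite !scale0r.
have da : dirder p v a = 0.
  by rewrite -(dirder_cst p v (1 : R)); apply/esym/dirder_eq; exact: Ua.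
have ap : a p = 1 by rewrite /a; case: asboolP.
case: HD => _ _ H _.
have H1 := H U p a Y oU Up sa sY v; have H2 := H U p a Z oU Up sa sZ v.
rewrite E H2 da ap !scale0r !add0r !scale1r in H1.
exact: esym.
Qed.

Lemma conn_zero p v : D p v (fun=> 0) = 0.
Proof.
have s0 : smooth_field_near p (fun=> 0).
  apply: nearW => q; apply: msmooth_at_eq (msmooth_at_cst q 0).
  by apply: nearW => z; rewrite mul0mx.
have := conn_add v s0 s0.
have -> : (fun=> 0 + 0) = (fun=> 0) :> (M -> 'rV[R]_m) by apply/funext => q; rewrite addr0.
by move/eqP; rewrite -subr_eq0 opprD addrA subrr sub0r oppr_eq0 => /eqP.
Qed.

Lemma smooth_field_near_sum p n (Y : 'I_n -> M -> 'rV[R]_m) :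
  (forall k, smooth_field_near p (Y k)) ->
  smooth_field_near p (fun q => \sum_k Y k q).
Proof.
move=> HY; have : \forall q \near p, forall k, smooth_field_at q (Y k).
  by apply: filter_forall.
by apply: filterS => q Hq; exact: smooth_along_at_sum.
Qed.

Lemma conn_sum p v n (Y : 'I_n -> M -> 'rV[R]_m) :
  (forall k, smooth_field_near p (Y k)) ->
  D p v (fun q => \sum_k Y k q) = \sum_k D p v (Y k).
Proof.
elim: n Y => [|n IH] Y HY.
  rewrite big_ord0 -[RHS](conn_zero p v); congr (D p v _).
  by apply/funext => q; rewrite big_ord0.
rewrite big_ord_recl -IH // -conn_add //; last exact: smooth_field_near_sum.
by congr (D p v _); apply/funext => q; rewrite big_ord_recl.
Qed.

Lemma conn_smooth p X Y : smooth_field_near p X -> smooth_field_near p Y ->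
  smooth_field_near p (fun q => D q (X q) Y).
Proof.
move=> HX HY; have [U [oU Up sX sY]] := smooth_field_near2P HX HY.
apply: filterS (open_nbhs_nbhs (conj oU Up)); apply/(smooth_fieldP _ oU).
by case: HD => _ _ _ H; exact: H.
Qed.

Lemma near_smooth_coord_field c k p : atlas c -> dom c p ->
  smooth_field_near p (coord_field c k).
Proof.
by move=> ac cp; apply: filterS (near_dom ac cp) => q; exact: smooth_coord_field.
Qed.

(** The connection matrix of the frame of c. When c is the chart at p and v a
    coordinate vector, its entries are Christoffel symbols. *)
Definition frame_conn c p v : 'M[R]_m := \matrix_(k < m) D p v (coord_field c k).

Lemma frame_conn_linear c p a v w : atlas c -> dom c p ->
  frame_conn c p (a *: v + w) = a *: frame_conn c p v + frame_conn c p w.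
Proof.
move=> ac cp; apply/row_matrixP => k; rewrite linearP /= !rowK.
by apply: conn_linear; exact: near_smooth_coord_field.
Qed.

Lemma frame_conn_sum c p v : atlas c -> dom c p ->
  frame_conn c p v = \sum_l (v *m tcoord c p) 0 l *: frame_conn c p (coord_field c l p).
Proof.
move=> ac cp.
have Ev : v = \sum_l (v *m tcoord c p) 0 l *: coord_field c l p.
  rewrite -[LHS]mulmx1 -(tcoord_frame ac cp) mulmxA mulmx_sum_row.
  by apply: eq_bigr => l _; rewrite coord_fieldE.
have E n (a : 'I_n -> R) (w : 'I_n -> 'rV[R]_m) :
    frame_conn c p (\sum_l a l *: w l) = \sum_l a l *: frame_conn c p (w l).
  have F0 : frame_conn c p 0 = 0.
    have := frame_conn_linear (-1) 0 0 ac cp.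
    by rewrite scaler0 addr0 => ->; rewrite scaleN1r addNr.
  elim: n a w => [|n IH] a w; first by rewrite !big_ord0.
  by rewrite !big_ord_recl frame_conn_linear // IH.
by rewrite {1}Ev E.
Qed.

(** The frame of c is A times that of d, A being the Jacobian of the change of
    charts: this is the Leibniz rule applied to its rows. *)
Lemma frame_conn_change c d p v : atlas c -> dom c p -> atlas d -> dom d p ->
  frame_conn c p v = dirder p v (chart_jac c d (fun q => q)) *m frame d p +
     chart_jac c d (fun q => q) p *m frame_conn d p v.
Proof.
move=> ac cp ad dp; set A := chart_jac c d (fun q => q).
have sA : \forall q \near p, msmooth_at q A.
  apply: filterS2 (near_dom ac cp) (near_dom ad dp) => q cq dq.
  by apply: msmooth_chart_jac => //; exact: smooth_map_id.
apply/row_matrixP => k; rewrite linearD /= rowK !row_mul !mulmx_sum_row.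
have sAl l : smooth_field_near p (fun q => A q k l *: coord_field d l q).
  apply: filterS2 sA (near_smooth_coord_field l ad dp) => q Aq dq.
  by apply: smooth_along_at_scale => //; exact: msmooth_at_entry.
have E : {near p, (fun q => \sum_l A q k l *: coord_field d l q) =1 coord_field c k}.
  apply: filterS2 (near_dom ac cp) (near_dom ad dp) => q cq dq.
  rewrite coord_fieldE -(transition_frame ac cq ad dq) row_mul mulmx_sum_row.
  by apply: eq_bigr => l _; rewrite !mxE.
rewrite -(conn_near_eq v _ E); last exact: smooth_field_near_sum.
rewrite conn_sum // -big_split; apply: eq_bigr => l _ /=.
rewrite conn_scale; last first.
- exact: near_smooth_coord_field.
- by apply: filterS sA => q; exact: msmooth_at_entry.
rewrite -dirder_entry; last exact: nbhs_singleton sA.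
by rewrite !mxE coord_fieldE rowK.
Qed.

End Connection.

Section CovAlong.
Context (R : realType) (m m' : nat) (M : smoothManifold R m) (M' : smoothManifold R m').
Context (D : conn_op M') (HD : linear_connection D).
Context (f : M -> M') (sf : smooth_map f).
Implicit Types (x y : M) (v w : 'rV[R]_m) (Y Z : M -> 'rV[R]_m') (e : chart R m' M').

Let af x : atlas (chart_at (f x)) := chart_at_atlas (f x).
Let df x : dom (chart_at (f x)) (f x) := chart_at_dom (f x).

Lemma cov_alongE x v Y : cov_along D f x v Y =
  dirder x v (fun y => Y y *m tcoord (chart_at (f x)) (f y)) +
  Y x *m frame_conn D (chart_at (f x)) (f x) (v *m tmap f x).
Proof.
rewrite /cov_along [X in _ = _ + X]mulmx_sum_row; congr (_ + _); apply: eq_bigr => k _.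
by rewrite rowK.
Qed.

(** The definition of cov_along uses the chart at f x; to follow its dependence
    on x, one chart e is needed for all nearby points. The terms in
    the derivative of the change of charts, one from the components of Y and one
    from frame_conn_change, cancel. *)
Lemma cov_along_chart e x v Y : smooth_along_at f x Y -> atlas e -> dom e (f x) ->
  cov_along D f x v Y =
  dirder x v (fun y => Y y *m tcoord e (f y)) *m frame e (f x) +
  (Y x *m tcoord e (f x)) *m frame_conn D e (f x) (v *m tmap f x).
Proof.
move=> HY ae ex; rewrite cov_alongE; set c := chart_at (f x).
set A := chart_jac c e (fun q => q).
have sA : msmooth_at (f x) A.
  exact: (msmooth_chart_jac (@smooth_map_id _ _ M') (af x) (df x) ae ex).
have E : {near x, (fun y => (Y y *m tcoord c (f y)) *m (A \o f) y) =1
                  (fun y => Y y *m tcoord e (f y))}.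
  apply: filterS2 (smooth_map_near sf (near_dom (af x) (df x)))
    (smooth_map_near sf (near_dom ae ex)) => y cy ey.
  by rewrite -mulmxA (tcoord_transition (af x) cy ae ey).
have sAf : msmooth_at x (A \o f) by exact: msmooth_at_pull sf sA.
have Ed : dirder x v (fun y => Y y *m tcoord e (f y)) =
    dirder x v (fun y => Y y *m tcoord c (f y)) *m A (f x) +
    (Y x *m tcoord c (f x)) *m dirder (f x) (v *m tmap f x) A.
  apply: (etrans (esym (dirder_eq v E))); apply: (etrans (dirder_mul v HY sAf)).
  exact: (congr1 (fun B => dirder x v (fun y => Y y *m tcoord c (f y)) *m A (f x) +
    (Y x *m tcoord c (f x)) *m B) (dirder_pull v sf sA)).
have EA : A (f x) *m frame e (f x) = 1%:M.
  by rewrite (transition_frame (af x) (df x) ae ex) frame_chart_at.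
have ET : tcoord e (f x) = A (f x).
  by rewrite -(tcoord_transition (af x) (df x) ae ex) tcoord_chart_at mul1mx.
have algebra (d1 d2 Yx : 'rV[R]_m') (T1 T2 A0 dA Fr G1 G2 : 'M[R]_m') :
    d2 = d1 *m A0 + (Yx *m T1) *m dA -> G1 = dA *m Fr + A0 *m G2 ->
    A0 *m Fr = 1%:M -> T2 = A0 -> T1 = 1%:M ->
    d1 + Yx *m G1 = d2 *m Fr + Yx *m T2 *m G2.
  move=> -> -> EF -> ->.
  by rewrite mulmx1 mulmxDl -!mulmxA EF mulmx1 mulmxDr addrA.
exact: (algebra _ _ _ _ _ _ _ _ _ _ Ed (frame_conn_change HD _ (af x) (df x) ae ex) EA ET
  (tcoord_chart_at _)).
Qed.

Lemma cov_along_linear x a v w Y : smooth_along_at f x Y ->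
  cov_along D f x (a *: v + w) Y = a *: cov_along D f x v Y + cov_along D f x w Y.
Proof.
move=> HY; rewrite !cov_alongE dirder_linear // mulmxDl -scalemxAl.
rewrite (frame_conn_linear HD _ _ _ (af x) (df x)) mulmxDr -scalemxAr scalerDr.
exact: addrACA.
Qed.

Lemma cov_along_add x v Y Z : smooth_along_at f x Y -> smooth_along_at f x Z ->
  cov_along D f x v (fun y => Y y + Z y) = cov_along D f x v Y + cov_along D f x v Z.
Proof.
move=> HY HZ; rewrite !cov_alongE mulmxDl addrACA.
congr (_ + _); apply: etrans (dirder_add v HY HZ).
by apply: dirder_eq; apply: nearW => y; rewrite mulmxDl.
Qed.

Lemma cov_along_scale x v (a : M -> R) Y : msmooth_at x a -> smooth_along_at f x Y ->
  cov_along D f x v (fun y => a y *: Y y) =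
  dirder x v a *: Y x + a x *: cov_along D f x v Y.
Proof.
move=> Ha HY; rewrite !cov_alongE -scalemxAl scalerDr addrA; congr (_ + _).
rewrite -[X in _ = _ *: X + _]mulmx1 -(tcoord_chart_at (f x)).
apply: etrans (dirder_scale v Ha HY).
by apply: dirder_eq; apply: nearW => y; rewrite scalemxAl.
Qed.

(** By linearity in the direction, the matrix is a combination of the fields
    D e_k along e_l, which are smooth by the axioms of a connection. *)
Lemma smooth_frame_conn e x (X : M -> 'rV[R]_m) : atlas e -> dom e (f x) ->
  (\forall y \near x, smooth_field_at y X) ->
  msmooth_at x (fun y => frame_conn D e (f y) (X y *m tmap f y) *m tcoord e (f y)).
Proof.
move=> ae ex HX.
pose G l q := frame_conn D e q (coord_field e l q) *m tcoord e q.
have sG l : msmooth_at (f x) (G l).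
  apply: msmooth_at_mx => k j.
  have Hs := conn_smooth HD (near_smooth_coord_field l ae ex) (near_smooth_coord_field k ae ex).
  have := (smooth_along_at_chart (@smooth_map_id _ _ M') _ ae ex).1 (nbhs_singleton Hs).
  move=> /(msmooth_at_entry 0 j); apply: msmooth_at_eq; apply: nearW => q.
  have -> : G l q k j = (row k (G l q)) 0 j by rewrite [RHS]mxE.
  by rewrite /G row_mul rowK.
have sW := (smooth_along_at_chart sf _ ae ex).1 (smooth_push sf (nbhs_singleton HX)).
have H : msmooth_at x (fun y => \sum_l (X y *m tmap f y *m tcoord e (f y)) 0 l *: (G l \o f) y).
  apply: msmooth_at_sum => l; apply: msmooth_at_scale; first exact: (msmooth_at_entry 0 l sW).
  exact: (msmooth_at_pull sf (sG l)).
apply: msmooth_at_eq H; apply: filterS (smooth_map_near sf (near_dom ae ex)) => y ey.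
rewrite [in RHS](frame_conn_sum HD _ ae ey) mulmx_suml; apply: eq_bigr => l _.
by rewrite scalemxAl.
Qed.

Lemma smooth_cov_along x (X : M -> 'rV[R]_m) Y :
  (\forall y \near x, smooth_field_at y X) ->
  (\forall y \near x, smooth_along_at f y Y) ->
  smooth_along_at f x (fun y => cov_along D f y (X y) Y).
Proof.
move=> HX HY; set e := chart_at (f x).
have near_e := smooth_map_near sf (near_dom (af x) (df x)).
pose Yh y := Y y *m tcoord e (f y).
have sYh : \forall y \near x, msmooth_at y Yh.
  apply: filterS2 HY near_e => y HYy ey.
  exact: (smooth_along_at_chart sf _ (af x) ey).1 HYy.
have H : msmooth_at x (fun y => dirder y (X y) Yh +
   Yh y *m (frame_conn D e (f y) (X y *m tmap f y) *m tcoord e (f y))).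
  apply: msmooth_at_add; first exact: (msmooth_dirder (nbhs_singleton HX) sYh).
  apply: msmooth_at_mul; first exact: nbhs_singleton sYh.
  exact: (smooth_frame_conn (af x) (df x) HX).
apply: msmooth_at_eq H; apply: filterS2 HY near_e => y HYy ey.
have algebra (d Yx : 'rV[R]_m') (Fr T G : 'M[R]_m') : Fr *m T = 1%:M ->
    d + Yx *m (G *m T) = (d *m Fr + Yx *m G) *m T.
  by move=> EF; rewrite mulmxDl -!mulmxA EF mulmx1.
apply: etrans (algebra _ _ _ _ _ (frame_tcoord (af x) ey)) _.
exact: (congr1 (mulmx^~ _) (esym (cov_along_chart (X y) HYy (af x) ey))).
Qed.

End CovAlong.

(** * Metric compatibility and torsion along a map *)

Section Metric.
Context (R : realType) (m m' nu : nat) (M : smoothManifold R m) (M' : smoothManifold R m').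
Context (g : M' -> 'M[R]_m') (D : conn_op M').
Context (Hg : pseudo_riemannian g nu) (HD : levi_civita g D).
Context (f : M -> M') (sf : smooth_map f).

Definition gram (c : chart R m' M') (p : M') : 'M[R]_m' :=
  frame c p *m g p *m (frame c p)^T.

Lemma gram_entry c p k l : gram c p k l = form (g p) (coord_field c k p) (coord_field c l p).
Proof.
rewrite /gram /form !coord_fieldE tr_row -row_mul -row_mul. 
by rewrite !mxE; apply: eq_bigr => i _; rewrite !mxE.
Qed.

Lemma smooth_gram c p : atlas c -> dom c p -> msmooth_at p (gram c).
Proof.
move=> ac cp; have [oc _ _ _ _] := atlas_chart ac; case: Hg => _ _ _ Hs.
apply: msmooth_at_mx => k l.
have H : smooth_fun (dom c) (fun q => form (g q) (coord_field c k q) (coord_field c l q)).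
  by apply: Hs => //; apply/(smooth_fieldP _ oc) => q cq; exact: smooth_coord_field.
apply: msmooth_at_eq ((smooth_funP _ oc).1 H p cp).
by apply: nearW => q; rewrite gram_entry.
Qed.

(** The condition D g = 0, tested on the coordinate fields of c. *)
Lemma dirder_gram c p v : atlas c -> dom c p ->
  dirder p v (gram c) =
  frame_conn D c p v *m g p *m (frame c p)^T + frame c p *m g p *m (frame_conn D c p v)^T.
Proof.
move=> ac cp; apply/matrixP => k l; rewrite dirder_entry; last exact: smooth_gram.
have [U [X [oU Up _ sX <-]]] := field_through p v.
have [oc _ _ _ _] := atlas_chart ac; case: HD => _ _ Hc.
have oUc : open (U `&` dom c) by exact: openI.
have sr Y : (forall q, dom c q -> smooth_field_at q Y) -> smooth_field (U `&` dom c) Y.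
  by move=> H; apply/(smooth_fieldP _ oUc) => q [_ /H].
have sXU := smooth_fieldS oUc oU (@subIsetl _ U (dom c)) sX.
have := Hc _ X (coord_field c k) (coord_field c l) oUc sXU
  (sr _ (fun q => @smooth_coord_field _ _ _ c k q ac))
  (sr _ (fun q => @smooth_coord_field _ _ _ c l q ac)) p (conj Up cp).
rewrite /cov_metric => /eqP; rewrite subr_eq0 subr_eq => /eqP E.
have E1 : dirder p (X p) (fun y => gram c y k l) =
    dirder p (X p) (fun y => form (g y) (coord_field c k y) (coord_field c l y)).
  by apply: dirder_eq; apply: nearW => q; rewrite gram_entry.
rewrite E1 E addrC mxE; congr (_ + _).
  rewrite /form coord_fieldE tr_row -[D _ _ _](rowK (fun k => D p (X p) (coord_field c k)) k).
  by rewrite -/(frame_conn D c p (X p)) -!row_mul !mxE; apply: eq_bigr => i _; rewrite !mxE.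
rewrite /form coord_fieldE -[D _ _ _](rowK (fun k => D p (X p) (coord_field c k)) l).
by rewrite -/(frame_conn D c p (X p)) tr_row -!row_mul !mxE; apply: eq_bigr => i _; rewrite !mxE.
Qed.

(** In the chart at f x the form is the product of the components of Y, the Gram
    matrix and the components of Z; dirder_gram and the chain rule give the
    derivative of the middle factor. *)
Lemma metric_along x v Y Z : smooth_along_at f x Y -> smooth_along_at f x Z ->
  dirder x v (fun y => form (g (f y)) (Y y) (Z y)) =
  form (g (f x)) (cov_along D f x v Y) (Z x) + form (g (f x)) (Y x) (cov_along D f x v Z).
Proof.
move=> HY HZ; set c := chart_at (f x).
have ac : atlas c by exact: chart_at_atlas.
have cx : dom c (f x) by exact: chart_at_dom.
pose Yh y := Y y *m tcoord c (f y); pose Zh y := Z y *m tcoord c (f y).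
pose F y := Yh y *m (gram c \o f) y *m (Zh y)^T.
have sG : msmooth_at x (gram c \o f) by apply: msmooth_at_pull => //; exact: smooth_gram.
have sZt : msmooth_at x (fun y => (Zh y)^T) by exact: msmooth_at_tr HZ.
have sYG : msmooth_at x (fun y => Yh y *m (gram c \o f) y) by apply: msmooth_at_mul.
have sF : msmooth_at x F by apply: msmooth_at_mul.
have -> : dirder x v (fun y => form (g (f y)) (Y y) (Z y)) = (dirder x v F) 0 0.
  rewrite dirder_entry //; apply: dirder_eq.
  apply: filterS (smooth_map_near sf (near_dom ac cx)) => y cy.
  rewrite /F /gram /form /Yh /Zh /= trmx_mul -!mulmxA.
  rewrite [in RHS](mulmxA (tcoord c (f y)) (frame c (f y))) tcoord_frame // mul1mx.
  rewrite (mulmxA (frame c (f y))^T) -trmx_mul tcoord_frame // trmx1 mul1mx //.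
have EY : Yh x = Y x by rewrite /Yh tcoord_chart_at mulmx1.
have EZ : Zh x = Z x by rewrite /Zh tcoord_chart_at mulmx1.
have E1 := dirder_mul v sYG sZt; have E2 := dirder_mul v HY sG.
have E3 := dirder_tr v HZ.
have E4 := etrans (dirder_pull v sf (smooth_gram ac cx)) (dirder_gram (v *m tmap f x) ac cx).
have E5 : (gram c \o f) x = g (f x) by rewrite /= /gram frame_chart_at trmx1 mulmx1 mul1mx.
have algebra (dF : 'M[R]_1) (dYG dY Yx Yx' dZ Zx Zx' : 'rV[R]_m') dZt dG G0 Gm Gam Fr :
    dF = dYG *m Zx'^T + (Yx' *m G0) *m dZt -> dYG = dY *m G0 + Yx' *m dG ->
    dZt = dZ^T -> dG = Gam *m Gm *m Fr^T + Fr *m Gm *m Gam^T -> G0 = Gm ->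
    Yx' = Yx -> Zx' = Zx -> Fr = 1%:M ->
    dF 0 0 = form Gm (dY + Yx *m Gam) Zx + form Gm Yx (dZ + Zx *m Gam).
  move=> -> -> -> -> -> -> -> ->; rewrite /form trmx1 !mulmx1 !mul1mx.
  rewrite [(dZ + _)^T]linearD /= [(Zx *m Gam)^T]trmx_mul !(mulmxDl, mulmxDr) !mulmxA.
  set P1 := _ *m Zx^T; set P2 := _ *m Zx^T; set P3 := _ *m dZ^T; set P4 := _ *m Zx^T.
  by move: P1 P2 P3 P4 => P1 P2 P3 P4; rewrite !mxE; ring.
rewrite !cov_alongE.
exact: (algebra _ _ _ _ _ _ _ _ _ _ _ _ _ _ E1 E2 E3 E4 E5 EY EZ (frame_chart_at _)).
Qed.

End Metric.

Section Torsion.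
Context (R : realType) (m : nat) (M : smoothManifold R m).
Context (D : conn_op M) (HD : linear_connection D) (TD : torsion_free D).

Lemma coord_field_bracket (c : chart R m M) k v p : atlas c -> dom c p ->
  dirder p v (fun q => coord_field c k q *m tcoord c q) = 0 :> 'rV[R]_m.
Proof.
move=> ac cp; apply: etrans (dirder_cst p v (row k 1%:M)).
apply: dirder_eq; apply: filterS (near_dom ac cp) => q cq.
by rewrite coord_fieldE -row_mul frame_tcoord.
Qed.

(** Coordinate fields have constant components in their own chart, so their
    bracket vanishes. *)
Lemma conn_coord_sym p k l : D p (coord_field (chart_at p) l p) (coord_field (chart_at p) k) =
  D p (coord_field (chart_at p) k p) (coord_field (chart_at p) l).
Proof.
have [ac cp] := (chart_at_atlas p, chart_at_dom p).
have [oc _ _ _ _] := atlas_chart ac.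
have sc j : smooth_field (dom (chart_at p)) (coord_field (chart_at p) j).
  by apply/(smooth_fieldP _ oc) => q cq; exact: smooth_coord_field.
apply/eqP; rewrite -subr_eq0; apply/eqP.
apply: (etrans (TD oc (sc l) (sc k) cp)).
by rewrite /lie_bracket !coord_field_bracket // subrr.
Qed.

Lemma frame_conn_sym p u w :
  u *m frame_conn D (chart_at p) p w = w *m frame_conn D (chart_at p) p u.
Proof.
have [ac cp] := (chart_at_atlas p, chart_at_dom p).
have E a b : a *m frame_conn D (chart_at p) p b =
   \sum_k \sum_l (a 0 k * b 0 l) *:
     D p (coord_field (chart_at p) l p) (coord_field (chart_at p) k).
  rewrite (frame_conn_sum HD b ac cp) tcoord_chart_at mulmx1 mulmx_sum_row.
  apply: eq_bigr => k _; rewrite raddf_sum scaler_sumr; apply: eq_bigr => l _.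
  have rZ (s : R) (B : 'M[R]_m) : row k (s *: B) = s *: row k B.
    by apply/rowP => j; rewrite !mxE.
  by rewrite /= rZ rowK scalerA.
rewrite !E exchange_big; apply: eq_bigr => l _; apply: eq_bigr => k _ /=.
by rewrite mulrC conn_coord_sym.
Qed.

End Torsion.

Section TorsionAlong.
Context (R : realType) (m m' : nat) (M : smoothManifold R m) (M' : smoothManifold R m').
Context (D : conn_op M') (HD : linear_connection D) (TD : torsion_free D).
Context (f : M -> M') (sf : smooth_map f).

(** Differentiating the components of Y and X yields the bracket. What remains
    are the second derivatives of f, symmetric by hessian_sym, and the
    Christoffel symbols, symmetric by frame_conn_sym. *)
Lemma torsion_along x (X Y : M -> 'rV[R]_m) :
  smooth_field_at x X -> smooth_field_at x Y ->
  cov_along D f x (X x) (fun y => Y y *m tmap f y) -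
  cov_along D f x (Y x) (fun y => X y *m tmap f y) =
  lie_bracket X Y x *m tmap f x.
Proof.
move=> sX sY; set c := chart_at x; set e := chart_at (f x).
have ac : atlas c by exact: chart_at_atlas.
have cx : dom c x by exact: chart_at_dom.
have ae : atlas e by exact: chart_at_atlas.
have ex : dom e (f x) by exact: chart_at_dom.
pose J := chart_jac c e f.
have sJ : msmooth_at x J by exact: msmooth_chart_jac.
have E v (Z : M -> 'rV[R]_m) : smooth_field_at x Z ->
    dirder x v (fun y => Z y *m tmap f y *m tcoord e (f y)) =
    dirder x v (fun y => Z y *m tcoord c y) *m tmap f x + Z x *m dirder x v J.
  move=> sZ; apply: (@etrans _ _ (dirder x v (fun y => (Z y *m tcoord c y) *m J y))).
    apply: dirder_eq; apply: filterS2 (near_dom ac cx) (smooth_map_near sf (near_dom ae ex)).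
    by move=> y cy ey; rewrite -!mulmxA (tmap_tcoord sf ac cy ae ey).
  apply: (etrans (dirder_mul v sZ sJ)).
  by congr (_ + _ *m _); rewrite tcoord_chart_at mulmx1.
have H u v : u *m dirder x v J = v *m dirder x u J.
  have EJ w : dirder x w J = 'D_w (fun q => 'J (coord e \o f \o icoord c) q) (coord c x).
    apply: near_eq_derive; apply: filterS (near_icoordK ac cx) => z.
    by rewrite /J /chart_jac /= => ->.
  apply: (etrans (congr1 (mulmx u) (EJ v))).
  apply: (etrans _ (esym (congr1 (mulmx v) (EJ u)))).
  exact: hessian_sym (smooth_map_chart sf ac cx ae ex).
have algebra (a b X0 Y0 : 'rV[R]_m) (JX JY T : 'M[R]_(m, m')) (GX GY : 'M[R]_m') :
    Y0 *m JX = X0 *m JY -> Y0 *m T *m GX = X0 *m T *m GY ->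
    (a *m T + Y0 *m JX + Y0 *m T *m GX) - (b *m T + X0 *m JY + X0 *m T *m GY) =
    (a - b) *m T.
  move=> -> ->; rewrite !opprD addrACA subrr addr0 addrACA subrr addr0.
  by rewrite mulmxBl.
rewrite !cov_alongE (E _ _ sX) (E _ _ sY).
apply: algebra; first exact: H.
exact: frame_conn_sym.
Qed.

End TorsionAlong.

(** * Normal sections of a hypersurface *)

Section LinearAlgebra.
Context (R : realType).

Lemma complete_row_free n (A : 'M[R]_(n, n.+1)) : row_free A ->
  exists a : 'rV[R]_n.+1, (col_mx a A : 'M[R]_n.+1) \in unitmx.
Proof.
move=> fA.
have [a aA] : exists a : 'rV[R]_n.+1, ~~ (a <= A)%MS.
  apply: contrapT => /forallNP H; have /mxrankS : ((1%:M : 'M[R]_n.+1) <= A)%MS.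
    by apply/row_subP => j; move/negP: (H (row j 1%:M)) => /negPn.
  by rewrite mxrank1 (eqnP fA) ltnn.
exists a; rewrite -row_free_unit; apply: inj_row_free => u.
have [s [t ->]] : exists (s : 'M[R]_1) (t : 'rV[R]_n), u = row_mx s t :> 'rV[R]_(1 + n).
  by exists (lsubmx (u : 'rV[R]_(1 + n))), (rsubmx (u : 'rV[R]_(1 + n))); rewrite hsubmxK.
rewrite (mul_row_col s t a A) => /eqP; rewrite addr_eq0 => /eqP E.
have s0 : s = 0.
  apply/eqP/negPn/negP => sn0; move/negP: aA; apply.
  have s00 : s 0 0 != 0.
    by apply: contra sn0 => /eqP s0; apply/eqP/rowP => j; rewrite !ord1 s0 mxE.
  have -> : a = (- (s 0 0)^-1 *: t) *m A.
    rewrite -scalemxAl scaleNr -scalerN -E [s]mx11_scalar mul_scalar_mx.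
    by rewrite scalerA mxE eqxx mulr1n mulVf // scale1r.
  exact: submxMl.
have /eqP : t *m A = 0 by rewrite -[LHS]opprK -E s0 mul0mx oppr0.
by rewrite mulmx_free_eq0 // => /eqP ->; rewrite s0 row_mx0.
Qed.

Lemma form_sym n (G : 'M[R]_n) u v : G^T = G -> form G u v = form G v u.
Proof.
move=> sG; rewrite /form; have -> : v *m G *m u^T = (u *m G *m v^T)^T.
  by rewrite !trmx_mul trmxK sG mulmxA.
by rewrite [RHS]mxE.
Qed.

Lemma formDl n (G : 'M[R]_n) u v w : form G (u + v) w = form G u w + form G v w.
Proof. by rewrite /form !mulmxDl mxE. Qed.

Lemma formZl n (G : 'M[R]_n) a u v : form G (a *: u) v = a * form G u v.
Proof. by rewrite /form -!scalemxAl mxE. Qed.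

Lemma formBl n (G : 'M[R]_n) u v w : form G (u - v) w = form G u w - form G v w.
Proof. by rewrite /form !mulmxBl !mxE. Qed.

Lemma form_push n k (G : 'M[R]_k) (P : 'M[R]_(n, k)) u v :
  form (P *m G *m P^T) u v = form G (u *m P) (v *m P).
Proof. by rewrite /form trmx_mul !mulmxA. Qed.

Lemma form_normal n k (G : 'M[R]_k) (P : 'M[R]_(n, k)) z xi : G^T = G ->
  (xi <= kermx (G *m P^T))%MS -> form G (z *m P) xi = 0.
Proof.
move=> sG /sub_kermxP E; rewrite (form_sym _ _ sG) /form trmx_mul.
by rewrite -!mulmxA [G *m _]mulmxA [xi *m _]mulmxA E mul0mx mxE.
Qed.

End LinearAlgebra.

Section NormalSection.
Context (R : realType) (n nu : nat).
Context (Mbar : smoothManifold R n.+2) (gbar : Mbar -> 'M[R]_n.+2).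
Context (M : smoothManifold R n.+1) (i : M -> Mbar).
Context (Hg : pseudo_riemannian gbar nu) (Hi : hypersurface i).

Let si : smooth_map i. Proof. by case: Hi. Qed.

(** In coordinates the normal space is the left kernel of a matrix K with n + 2
    rows and n + 1 columns, of full rank and smooth in the point. If the column
    b makes [b | K] invertible at x, then the first row of the inverse of
    [b | K] is smooth, nonzero and annihilates K near x. *)
Lemma exists_normal_section x : exists U xi,
  [/\ coord_nbhd U, U x & normal_section gbar i U xi].
Proof.
set c := chart_at x; set e := chart_at (i x).
have ac : atlas c by exact: chart_at_atlas.
have cx : dom c x by exact: chart_at_dom.
have ae : atlas e by exact: chart_at_atlas.
have ex : dom e (i x) by exact: chart_at_dom.
have near_ce : \forall y \near x, dom c y /\ dom e (i y).
  exact: filterI (near_dom ac cx) (smooth_map_near si (near_dom ae ex)).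
pose K y : 'M[R]_(n.+2, n.+1) := gram gbar e (i y) *m (chart_jac c e i y)^T.
have sK y : dom c y -> dom e (i y) -> msmooth_at y K.
  move=> cy ey.
  have sG : msmooth_at y (gram gbar e \o i) := msmooth_at_pull si (smooth_gram Hg ae ey).
  have sJ := msmooth_chart_jac si ac cy ae ey.
  exact: (msmooth_at_mul sG (msmooth_at_tr sJ)).
have KE y : dom c y -> dom e (i y) ->
    K y = frame e (i y) *m (gbar (i y) *m (tmap i y)^T) *m (frame c y)^T.
  move=> cy ey; rewrite /K /gram -!mulmxA; congr (_ *m (_ *m _)).
  rewrite -!trmx_mul; congr (_^T).
  have algebra (Fc Tc : 'M[R]_n.+1) (Fe Te : 'M[R]_n.+2) (P J : 'M[R]_(n.+1, n.+2)) :
      Fc *m Tc = 1%:M -> Te *m Fe = 1%:M -> P *m Te = Tc *m J -> J *m Fe = Fc *m P.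
    move=> EF ET EP; rewrite -[RHS]mulmx1 -ET mulmxA -[Fc *m P *m Te]mulmxA EP.
    by rewrite mulmxA EF mul1mx.
  exact: algebra (frame_tcoord ac cy) (tcoord_frame ae ey) (tmap_tcoord si ac cy ae ey).
have [b Hb] : exists b : 'cV[R]_n.+2, (row_mx b (K x) : 'M[R]_n.+2) \in unitmx.
  have fK : row_free (K x)^T.
    rewrite KE // !frame_chart_at trmx1 mul1mx mulmx1 trmx_mul trmxK.
    rewrite /row_free mxrankMfree; first by case: Hi => _ _; exact.
    by case: Hg => sG uG _ _; rewrite sG row_free_unit.
  have [a Ha] := complete_row_free fK; exists a^T.
  have E : (row_mx a^T (K x) : 'M[R]_n.+2)^T = col_mx a (K x)^T.
    by apply: (etrans (tr_row_mx a^T (K x))); rewrite trmxK.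
  by rewrite -unitmx_tr E.
pose B y : 'M[R]_n.+2 := row_mx b (K y).
have sB y : dom c y -> dom e (i y) -> msmooth_at y B.
  move=> cy ey; apply: msmooth_at_mx => k l; case: (split_ordP (l : 'I_(1 + n.+1))) => j ->.
    apply: msmooth_at_eq (msmooth_at_cst y (b k j)).
    by apply: nearW => z; exact: esym (row_mxEl b (K z) k j).
  apply: msmooth_at_eq (msmooth_at_entry k j (sK y cy ey)).
  by apply: nearW => z; exact: esym (row_mxEr b (K z) k j).
have nB := near_unitmx (sB x cx ex) Hb.
have [U [oU Ux HU]] := near_open (filterI near_ce nB).
pose xih y : 'rV[R]_n.+2 := row 0 (invmx (B y)).
exists U, (fun y => xih y *m frame e (i y)); split=> //.
  by split=> //; exists c => // y /HU[[]].
split.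
  apply: ((smooth_alongP si _ oU).2) => y /HU[[cy ey] By].
  apply: (smooth_along_at_frame si ae ey); apply: msmooth_at_mx => k l.
  apply: msmooth_at_eq (msmooth_at_entry 0 l (msmooth_at_invmx By (sB y cy ey))).
  by apply: nearW => z; rewrite /xih ord1 mxE.
move=> y /HU[[cy ey] By].
have EB : xih y *m B y = delta_mx 0 0 by rewrite /xih -row_mul mulVmx // rowE mulmx1.
have EK : xih y *m K y = 0.
  have E : row_mx (xih y *m b) (xih y *m K y) = delta_mx 0 0.
    by rewrite -EB; exact: esym (mul_mx_row (xih y) b (K y)).
  apply/rowP => j; rewrite -(row_mxEr (xih y *m b)) E.
  by rewrite !mxE.
split.
  apply/eqP => /(congr1 (mulmx^~ (tcoord e (i y)))).
  rewrite -mulmxA frame_tcoord // mulmx1 mul0mx => xi0.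
  have := congr1 (fun u : 'rV[R]_n.+2 => u 0 0) EB; rewrite xi0 mul0mx !mxE eqxx.
  by move/eqP; rewrite eq_sym oner_eq0.
apply/sub_kermxP; rewrite -[LHS]mulmx1 -trmx1 -(tcoord_frame ac cy) trmx_mul !mulmxA.
have -> : xih y *m frame e (i y) *m gbar (i y) *m (tmap i y)^T *m (frame c y)^T = xih y *m K y.
  by rewrite KE // !mulmxA.
by rewrite EK mul0mx.
Qed.

End NormalSection.

(** * The induced connection of a lightlike hypersurface *)

Section Lightlike.
Context (R : realType) (n nu : nat).
Context (Mbar : smoothManifold R n.+2) (gbar : Mbar -> 'M[R]_n.+2).
Context (Dbar : conn_op Mbar).
Context (M : smoothManifold R n.+1) (i : M -> Mbar).
Context (S : M -> 'M[R]_n.+1) (tr : M -> 'M[R]_n.+2).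
Context (gbar_metric : pseudo_riemannian gbar nu).
Context (Dbar_lc : levi_civita gbar Dbar).
Context (M_hyp : hypersurface i).
Context (S_screen : screen gbar i S).
Context (tr_transversal : transversal_bundle gbar i S tr).

Let si : smooth_map i. Proof. by case: M_hyp. Qed.
Let freeP x : row_free (tmap i x). Proof. by case: M_hyp. Qed.
Let symG p : (gbar p)^T = gbar p. Proof. by case: gbar_metric. Qed.
Let linD : linear_connection Dbar. Proof. by case: Dbar_lc. Qed.
Let torD : torsion_free Dbar. Proof. by case: Dbar_lc. Qed.

Local Notation G x := (gbar (i x)).
Local Notation P x := (tmap i x).
Local Notation nabla := (induced_connection Dbar i tr).
Local Notation acov := (ambient_cov Dbar i).

(** The values at x of sections xi and N paired as in the definition of the
    transversal bundle. *)
Definition null_pair x xi N :=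
  [/\ (xi <= normal_space gbar i x)%MS, (N <= tr x)%MS & form (G x) N xi = 1].

Lemma exists_null_pair x : exists xi N, null_pair x xi N.
Proof.
have [U [X [cU Ux nX]]] := exists_normal_section gbar_metric M_hyp x.
have [_ H] := tr_transversal; have [N [_ HN] _] := H U X cU nX.
have [NT NX _ _] := HN x Ux; exists (X x), (N x); split=> //.
by have [_ nXx] := nX; have [] := nXx x Ux.
Qed.

Section AtPoint.
Context (x : M) (xi N : 'rV[R]_n.+2) (NP : null_pair x xi N).

Lemma tangent_normal z : form (G x) (z *m P x) xi = 0.
Proof. by case: NP => xiN _ _; exact: form_normal. Qed.

Lemma trE : (tr x :=: N)%MS.
Proof.
case: NP => _ NT NX.
have [/(_ x)[rk _] _] := tr_transversal.
have N0 : N != 0.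
  apply/eqP => N0; move: NX; rewrite N0 /form !mul0mx mxE => /eqP.
  by rewrite eq_sym oner_eq0.
apply/eqmxP; rewrite NT andbT -(mxrank_leqif_sup NT) rk rank_rV N0 //.
Qed.

Lemma tangent_tr_disjoint : (<<P x>> :&: tr x)%MS = 0.
Proof.
apply/eqP/rowV0P => v; rewrite sub_capmx genmxE trE => /andP[/submxP[z vz] /sub_rVP[a va]].
have [_ _ NX] := NP.
have := tangent_normal z; rewrite -vz va formZl NX mulr1 => ->.
by rewrite scale0r.
Qed.

(** N spans the transversal line and xi is orthogonal to the tangent space, so
    the transversal component of w is read off by pairing w with xi. *)
Lemma tangent_projE w :
  tangent_proj i tr x w *m P x = w - form (G x) w xi *: N.
Proof.
have sub_all : (w <= <<P x>> + tr x)%MS.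
  apply: submx_full; rewrite -col_leq_rank mxrank_disjoint_sum; last exact: tangent_tr_disjoint.
  rewrite mxrank_gen (eqnP (freeP x)).
  by have [/(_ x)[-> _] _] := tr_transversal; rewrite addn1.
have D := add_proj_mx tangent_tr_disjoint sub_all.
set u := w *m proj_mx <<P x>>%MS (tr x) in D.
have uP : tangent_proj i tr x w *m P x = u.
  by rewrite /tangent_proj -/u mulmxKpV // -(genmxE (P x)) proj_mx_sub.
have : (w *m proj_mx (tr x) <<P x>> <= tr x)%MS by exact: proj_mx_sub.
rewrite trE => /sub_rVP[a Ea]; rewrite Ea in D.
have [_ _ NX] := NP.
have -> : form (G x) w xi = a.
  by rewrite -D formDl -uP tangent_normal add0r formZl NX mulr1.
by rewrite uP -D addrK.
Qed.

Lemma second_fundamental_formE X Y :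
  second_fundamental_form Dbar i tr X Y x = form (G x) (acov x (X x) Y) xi *: N.
Proof. by rewrite /second_fundamental_form /induced_connection tangent_projE subKr. Qed.

(** The ambient derivative of the metric vanishes; what is left comes from the
    transversal parts removed by the projection. *)
Lemma cov_metric_induced v Y Z : smooth_field_at x Y -> smooth_field_at x Z ->
  cov_metric (induced_metric gbar i) nabla x v Y Z =
  form (G x) (acov x v Y) xi * form (G x) N (Z x *m P x) +
  form (G x) (acov x v Z) xi * form (G x) N (Y x *m P x).
Proof.
move=> sY sZ; rewrite /cov_metric.
have E : dirder x v (fun y => form (induced_metric gbar i y) (Y y) (Z y)) =
    dirder x v (fun y => form (G y) (Y y *m P y) (Z y *m P y)).
  by apply: dirder_eq; apply: nearW => y; exact: form_push.
have E2 := metric_along gbar_metric Dbar_lc si v (smooth_push si sY) (smooth_push si sZ).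
rewrite E E2 /induced_metric !form_push /induced_connection !tangent_projE.
rewrite ![form _ (Y x *m P x) _](form_sym _ _ (symG _)) !formBl !formZl.
by rewrite /ambient_cov; ring.
Qed.

End AtPoint.

(** Test the Weyl condition on a field Z with Z x = xi: first with Y = Z, which
    gives B(X, Z) = 0, then with the given Y. *)
Lemma weyl_totally_geodesic :
  weyl_connection (induced_metric gbar i) nabla -> totally_geodesic Dbar i tr.
Proof.
move=> [_ _ [theta _ W]] U X Y oU sX sY x Ux.
have [xi [N NP]] := exists_null_pair x; have [xiN _ NX] := NP.
have [z Ez] : exists z, xi = z *m P x.
  have [_ /(_ x)[_ E]] := S_screen; apply/submxP.
  by rewrite -E; apply: submx_trans xiN _; exact: addsmxSr.
have [V [Z [oV Vx _ sZ Zx]]] := field_through x z.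
have oUV : open (U `&` V) by exact: openI.
have sX' := smooth_fieldS oUV oU (@subIsetl _ U V) sX.
have sY' := smooth_fieldS oUV oU (@subIsetl _ U V) sY.
have sZ' := smooth_fieldS oUV oV (@subIsetr _ U V) sZ.
have Yx := (smooth_fieldP _ oU).1 sY x Ux; have Zsx := (smooth_fieldP _ oV).1 sZ x Vx.
have gZ u : form (induced_metric gbar i x) u (Z x) = 0.
  by rewrite form_push Zx -Ez; exact: tangent_normal NP _.
have BZ := W _ X Z Z oUV sX' sZ' sZ' x (conj Ux Vx).
rewrite gZ mulr0 (cov_metric_induced NP) // Zx -Ez NX !mulr1 in BZ.
have {}BZ : form (G x) (acov x (X x) Z) xi = 0.
  by move/eqP: BZ; rewrite -mulr2n mulrn_eq0 => /eqP.
have BY := W _ X Y Z oUV sX' sY' sZ' x (conj Ux Vx).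
rewrite gZ mulr0 (cov_metric_induced NP) // BZ mul0r addr0 Zx -Ez NX mulr1 in BY.
by rewrite (second_fundamental_formE NP) BY scale0r.
Qed.

(** The differential of the immersion maps nabla_v Y to the ambient derivative of
    Y, without transversal part. It is injective, so the required identities can
    be checked on the images. *)
Lemma totally_geodesic_weyl :
  totally_geodesic Dbar i tr -> weyl_connection (induced_metric gbar i) nabla.
Proof.
move=> TG.
have nablaE x v Y : smooth_field_near x Y -> nabla x v Y *m P x = acov x v Y.
  move=> /smooth_field_nearP[U [oU Ux sY]].
  have [V [X [oV Vx _ sX <-]]] := field_through x v.
  have oUV : open (U `&` V) by exact: openI.
  have sX' := smooth_fieldS oUV oV (@subIsetr _ U V) sX.
  have sY' := smooth_fieldS oUV oU (@subIsetl _ U V) sY.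
  by apply/esym/eqP; rewrite -subr_eq0; apply/eqP; exact: (TG _ X Y oUV sX' sY' x (conj Ux Vx)).
have injP x (a b : 'rV[R]_n.+1) : a *m P x = b *m P x -> a = b.
  exact: row_free_inj.
have sP x Y : smooth_field_near x Y -> smooth_along_at i x (fun y => Y y *m P y).
  by move=> /nbhs_singleton; exact: smooth_push.
split.
- split.
  + move=> U x Y oU Ux sY a v w; have nY := smooth_field_nearI oU Ux sY.
    apply: (injP x); rewrite mulmxDl -scalemxAl !nablaE //.
    exact: (cov_along_linear linD a v w (sP _ _ nY)).
  + move=> U x Y Z oU Ux sY sZ v.
    have nY := smooth_field_nearI oU Ux sY; have nZ := smooth_field_nearI oU Ux sZ.
    have nYZ : smooth_field_near x (fun y => Y y + Z y).
      by apply: filterS2 nY nZ => y; exact: smooth_along_at_add.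
    apply: (injP x); rewrite mulmxDl !nablaE //.
    have E := cov_along_add Dbar v (sP _ _ nY) (sP _ _ nZ).
    apply: etrans E; congr (cov_along Dbar i x v _); apply/funext => y; exact: mulmxDl.
  + move=> U x a Y oU Ux sa sY v.
    have nY := smooth_field_nearI oU Ux sY.
    have na : \forall y \near x, msmooth_at y a.
      apply: filterS (open_nbhs_nbhs (conj oU Ux)); exact: ((smooth_funP _ oU).1 sa).
    have naY : smooth_field_near x (fun y => a y *: Y y).
      by apply: filterS2 na nY => y; exact: smooth_along_at_scale.
    apply: (injP x); rewrite mulmxDl -!scalemxAl !nablaE //.
    have E := cov_along_scale Dbar v (nbhs_singleton na) (sP _ _ nY).
    apply: etrans E; congr (cov_along Dbar i x v _); apply/funext => y.
    exact/esym/scalemxAl.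
  + move=> U X Y oU sX sY; apply/(smooth_fieldP _ oU) => x Ux.
    have nY := smooth_field_nearI oU Ux sY; have nX := smooth_field_nearI oU Ux sX.
    apply: (smooth_push_inv si (freeP x)).
    apply: smooth_along_at_eq (smooth_cov_along linD si nX _); last first.
      apply: filterS nY => y; exact: (smooth_push si).
    apply: filterS (nbhs_interior nY) => y nYy; apply/esym; exact: nablaE.
- move=> U X Y oU sX sY x Ux.
  have nY := smooth_field_nearI oU Ux sY; have nX := smooth_field_nearI oU Ux sX.
  apply: (injP x); rewrite mulmxBl !nablaE //.
  exact: (torsion_along linD torD si (nbhs_singleton nX) (nbhs_singleton nY)).
exists (fun=> 0).
  move=> U X oU sX; apply/(smooth_funP _ oU) => x Ux.
  apply: msmooth_at_eq (msmooth_at_cst x (0 : R)).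
  by apply: nearW => y; rewrite mulmx0 mxE.
move=> U X Y Z oU sX sY sZ x Ux; rewrite mulmx0 mxE mul0r.
have nY := smooth_field_nearI oU Ux sY; have nZ := smooth_field_nearI oU Ux sZ.
have [xi [N NP]] := exists_null_pair x.
have B0 (T : M -> 'rV[R]_n.+1) : smooth_field_near x T -> form (G x) (acov x (X x) T) xi = 0.
  by move=> nT; rewrite -nablaE //; exact: tangent_normal NP _.
rewrite (cov_metric_induced NP) ?B0 ?mul0r ?addr0 //.
  exact: nbhs_singleton nY.
exact: nbhs_singleton nZ.
Qed.

(** A Weyl connection would give B = 0, hence lambda g = 0 and g = 0, although the
    rank n of g is positive. *)
Lemma proper_umbilical_not_weyl : (0 < n)%N -> lightlike gbar i -> [set: M] !=set0 ->
  proper_totally_umbilical gbar Dbar i ->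
  ~ weyl_connection (induced_metric gbar i) nabla.
Proof.
move=> n0 LL [x _] PU /weyl_totally_geodesic TG.
have [U [xi [cU Ux nxi]]] := exists_normal_section gbar_metric M_hyp x.
have [lambda [_ Hl] l0] := PU U xi cU nxi.
have [oU _] := cU.
have [_ [c ac Uc]] := cU; have cx := Uc x Ux.
pose ext u y : 'rV[R]_n.+1 := (u *m tcoord c x) *m frame c y.
have sext u : smooth_field U (ext u).
  by apply/(smooth_fieldP _ oU) => y /Uc cy; exact: smooth_const_field.
have extx u : ext u x = u by rewrite /ext -mulmxA tcoord_frame // mulmx1.
have H u v : form (induced_metric gbar i x) u v = 0.
  have /eqP := Hl _ _ (sext u) (sext v) x Ux.
  have /eqP := TG U _ _ oU (sext u) (sext v) x Ux.
  rewrite /second_fundamental_form subr_eq0 => /eqP E.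
  have -> : local_second_form gbar Dbar i xi (ext u) (ext v) x = 0.
    rewrite /local_second_form E; have [_ /(_ x Ux)[_ nx]] := nxi.
    exact: form_normal.
  by rewrite !extx eq_sym mulf_eq0 (negPf (l0 x Ux)) => /eqP.
have g0 : induced_metric gbar i x = 0.
  apply/matrixP => k l; have := H (delta_mx 0 k) (delta_mx 0 l).
  by rewrite /form -rowE trmx_delta -colE !mxE.
by have := LL x; rewrite g0 mxrank0 => n00; rewrite -n00 in n0.
Qed.

End Lightlike.

Theorem theorem3p1 (R : realType) (n nu : nat)
    (Mbar : smoothManifold R n.+2) (gbar : Mbar -> 'M[R]_n.+2)
    (Dbar : conn_op Mbar)
    (M : smoothManifold R n.+1) (i : M -> Mbar)
    (S : M -> 'M[R]_n.+1) (tr : M -> 'M[R]_n.+2)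
    (nu_bounds : (0 < nu < n.+2)%N)
    (gbar_metric : pseudo_riemannian gbar nu)
    (Dbar_lc : levi_civita gbar Dbar)
    (M_hyp : hypersurface i)
    (M_light : lightlike gbar i)
    (S_screen : screen gbar i S)
    (tr_transversal : transversal_bundle gbar i S tr) :
  (weyl_connection (induced_metric gbar i) (induced_connection Dbar i tr)
     <-> totally_geodesic Dbar i tr) /\
  ((0 < n)%N -> [set: M] !=set0 -> proper_totally_umbilical gbar Dbar i ->
     ~ weyl_connection (induced_metric gbar i) (induced_connection Dbar i tr)).
Proof.
split; last first.
  move=> n0 M0 PU.
  exact: (proper_umbilical_not_weyl gbar_metric Dbar_lc M_hyp S_screen
    tr_transversal n0 M_light M0 PU).
split.
  exact: (weyl_totally_geodesic gbar_metric Dbar_lc M_hyp S_screen tr_transversal).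
exact: (totally_geodesic_weyl gbar_metric Dbar_lc M_hyp tr_transversal).
Qed.
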